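(* Let $\phi(p)\in\mathrm{SO}_{d[0,1]}(\mathrm{SUM},\times)$ be a formula (with $p$ a $k$-ary function variable, its only free variable) of the form $Q_1f_1\dots Q_nf_n\forall\bar x\,\theta$, where each $Q_i\in\{\exists,\forall\}$, $\theta$ is quantifier-free, and every numerical identity atom of $\theta$ (possibly negated) has the form $f_i(\bar u\bar v)=f_j(\bar u)\times f_k(\bar v)$ or $f_i(\bar u)=\mathrm{SUM}_{\bar v}f_j(\bar u\bar v)$ for distinct $f_i,f_j,f_k\in\{f_1,\dots,f_n,p\}$. Then there is a formula $\Phi\in\mathrm{FO}(\perp\!\!\!\perp_c,\sim,\approx)$ with free variables among $v_1,\dots,v_k$ such that for all finite structures $\mathcal A$ and all probability distributions $p^{\mathcal A}$ on $A^k$, letting $\mathbb X$ be the probabilistic team over $\{v_1,\dots,v_k\}$ with $\mathbb X(s)=p^{\mathcal A}(s(v_1),\dots,s(v_k))$: $\mathcal A\models_{\mathbb X}\Phi$ iff $(\mathcal A,p^{\mathcal A})\models\phi$.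
   Context: Probabilistic team semantics. Fix a finite relational vocabulary $\tau$ containing $=$; structures $\mathcal A$ are finite $\tau$-structures with universe $A$. An assignment over a finite set $D$ of variables is a map $s\colon D\to A$; $s(a/x)$ maps $x$ to $a$ and agrees with $s$ elsewhere. A probabilistic team over $D$ is $\mathbb X\colon X\to[0,1]$ with $\sum_{s\in X}\mathbb X(s)=1$, $X$ a finite set of assignments over $D$; $\mathrm{supp}(\mathbb X)=\{s:\mathbb X(s)\ne0\}$; $|\mathbb X_{\bar x=\bar a}|=\sum_{s(\bar x)=\bar a}\mathbb X(s)$. $\mathbb X(F/x)(s(a/x))=\sum_{t\in X,\ t(a/x)=s(a/x)}\mathbb X(t)F(t)(a)$ for $F$ assigning to each $t\in X$ a distribution on $A$; $\mathbb X(A/x)$ uses uniform $F(t)$; $\mathbb Y\sqcup_k\mathbb Z$ is $s\mapsto k\mathbb Y(s)+(1-k)\mathbb Z(s)$. Syntax of $\mathrm{FO}(\perp\!\!\!\perp_c,\sim,\approx)$: $\phi::=R(\bar x)\mid\neg R(\bar x)\mid\bar y\perp\!\!\!\perp_{\bar x}\bar z\mid\bar x\approx\bar y\mid\sim\phi\mid\phi\wedge\phi\mid\phi\vee\phi\mid\exists x\phi\mid\forall x\phi$. Semantics: literals hold in $\mathbb X$ iff every $s\in\mathrm{supp}(\mathbb X)$ satisfies them; $\bar y\perp\!\!\!\perp_{\bar x}\bar z$ holds iff $|\mathbb X_{\bar x\bar y=s(\bar x\bar y)}|\cdot|\mathbb X_{\bar x\bar z=s(\bar x\bar z)}|=|\mathbb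 X_{\bar x\bar y\bar z=s(\bar x\bar y\bar z)}|\cdot|\mathbb X_{\bar x=s(\bar x)}|$ for all $s\colon\mathrm{Var}(\bar x\bar y\bar z)\to A$; $\bar x\approx\bar y$ (equal lengths) holds iff $|\mathbb X_{\bar x=\bar a}|=|\mathbb X_{\bar y=\bar a}|$ for all $\bar a$; $\sim$ is Boolean negation; $\wedge$ classical; $\phi\vee\psi$ holds in $\mathbb X$ iff $\phi$ holds in $\mathbb Y$ and $\psi$ in $\mathbb Z$ for some $\mathbb Y,\mathbb Z,k$ with $\mathbb Y\sqcup_k\mathbb Z=\mathbb X$; $\exists x\phi$ holds iff $\phi$ holds in some $\mathbb X(F/x)$; $\forall x\phi$ holds iff $\phi$ holds in $\mathbb X(A/x)$. $\mathrm{SO}_{d[0,1]}(\mathrm{SUM},\times)$: over expansions of finite $\tau$-structures by real-valued functions, numerical terms $i::=f(\bar x)\mid i\times i\mid\mathrm{SUM}_{\bar y}i$ ($\mathrm{SUM}_{\bar y}i$ sums $i$ over all values $\bar b\in A^{|\bar y|}$ of $\bar y$), formulas $i=j\mid\neg i=j\mid R(\bar x)\mid\neg R(\bar x)\mid\wedge\mid\vee\mid\exists x\mid\forall x\mid\exists f\mid\forall f$, first-order quantifiers over $A$, function quantifiers over probability distributions on $A^{\mathrm{Ar}(f)}$. *)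

(* Defs.v *)
From HB Require Import structures.
From mathcomp Require Import all_boot all_order all_algebra.
From mathcomp Require Export reals.
Set Implicit Arguments. Unset Strict Implicit. Unset Printing Implicit Defensive.
Import Order.TTheory GRing.Theory Num.Theory.
Local Open Scope ring_scope.

(* A finite relational vocabulary: finitely many relation symbols with
   arities.  The equality symbol "=" is built into both logics as a
   separate atom, always interpreted as identity. *)
Record voc := Voc { sym : finType; ar : sym -> nat }.

Record struc (t : voc) := Struc {
  dom :> finType;
  pt : dom;
  interp : forall r : sym t, pred ((ar r).-tuple dom) }.

Inductive fo (t : voc) :=
| FRel  (r : sym t) (xs : (ar r).-tuple nat)
| FNRel (r : sym t) (xs : (ar r).-tuple nat)
| FEq  (x y : nat)
| FNEq (x y : nat)
| FCInd (xs ys zs : seq nat)                       (* ys _|_ _xs zs *)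
| FApprox (n : nat) (xs ys : n.-tuple nat)
| FNeg (phi : fo t)
| FAnd (phi psi : fo t)
| FOr  (phi psi : fo t)
| FEx  (x : nat) (phi : fo t)
| FAll (x : nat) (phi : fo t).

Arguments FEq {t}. Arguments FNEq {t}. Arguments FCInd {t}. Arguments FApprox {t}.

Fixpoint fo_fv t (phi : fo t) : seq nat :=
  match phi with
  | FRel _ xs | FNRel _ xs => val xs
  | FEq x y | FNEq x y => [:: x; y]
  | FCInd xs ys zs => xs ++ ys ++ zs
  | FApprox _ xs ys => val xs ++ val ys
  | FNeg p => fo_fv p
  | FAnd p q | FOr p q => fo_fv p ++ fo_fv q
  | FEx x p | FAll x p => [seq y <- fo_fv p | y != x]
  end.

Section TeamSemantics.
Variable (R : numFieldType) (t : voc) (S : struc t).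
Let A : finType := dom S.

(* An assignment over D is represented by a total map nat -> A, of which
   only the values on D are meaningful; a probabilistic team over D is
   represented by a finite list of weighted assignments (the weight of an
   assignment over D is the total weight of the entries restricting to it). *)
Local Notation team := (seq ((nat -> A) * R)).

Definition is_team (X : team) : Prop :=
  all (fun e => 0 <= e.2) X /\ \sum_(e <- X) e.2 = 1.

Definition mass (X : team) (P : (nat -> A) -> bool) : R :=
  \sum_(e <- X | P e.1) e.2.

Definition agree (vs : seq nat) (s s' : nat -> A) : bool :=
  [seq s' v | v <- vs] == [seq s v | v <- vs].

Definition team_eq (D : seq nat) (X Y : team) : Prop :=
  forall s : nat -> A, mass X (agree D s) = mass Y (agree D s).

Definition mix (k : R) (Y Z : team) : team :=
  [seq (e.1, k * e.2) | e <- Y] ++ [seq (e.1, (1 - k) * e.2) | e <- Z].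

Definition upd (s : nat -> A) (x : nat) (a : A) : nat -> A :=
  fun y => if y == x then a else s y.

(* X(F/x), where F i is the distribution attached to the i-th entry of X *)
Definition supp_ext (X : team) (x : nat) (F : nat -> A -> R) : team :=
  flatten [seq [seq (upd e.2.1 x a, e.2.2 * F e.1 a) | a <- enum A]
          | e <- zip (iota 0 (size X)) X].

Definition is_distA (g : A -> R) : Prop :=
  (forall a, 0 <= g a) /\ \sum_a g a = 1.

Definition unif_ext (X : team) (x : nat) : team :=
  supp_ext X x (fun _ _ => (#|A|%:R)^-1).

Fixpoint fo_sat (D : seq nat) (X : team) (phi : fo t) {struct phi} : Prop :=
  match phi with
  | FRel r xs => all (fun e => (e.2 != 0) ==> @interp t S r (map_tuple e.1 xs)) X
  | FNRel r xs => all (fun e => (e.2 != 0) ==> ~~ @interp t S r (map_tuple e.1 xs)) X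
  | FEq x y => all (fun e => (e.2 != 0) ==> (e.1 x == e.1 y)) X
  | FNEq x y => all (fun e => (e.2 != 0) ==> (e.1 x != e.1 y)) X
  | FCInd xs ys zs => forall s : nat -> A,
      mass X (agree (xs ++ ys) s) * mass X (agree (xs ++ zs) s)
      = mass X (agree (xs ++ ys ++ zs) s) * mass X (agree xs s)
  | FApprox n xs ys => forall a : n.-tuple A,
      mass X (fun s => [seq s v | v <- xs] == val a)
      = mass X (fun s => [seq s v | v <- ys] == val a)
  | FNeg p => ~ fo_sat D X p
  | FAnd p q => fo_sat D X p /\ fo_sat D X q
  | FOr p q => exists (Y Z : team) (k : R),
      is_team Y /\ is_team Z /\ 0 <= k <= 1 /\ team_eq D X (mix k Y Z) /\
      fo_sat D Y p /\ fo_sat D Z q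
  | FEx x p => exists F : nat -> A -> R,
      (forall i, (i < size X)%N -> is_distA (F i)) /\
      fo_sat (x :: D) (supp_ext X x F) p
  | FAll x p => fo_sat (x :: D) (unif_ext X x) p
  end.

End TeamSemantics.

(* A function variable is identified by its arity m together with a
   name f : nat; terms are arity-correct by typing. *)
Inductive nterm :=
| NF (m f : nat) (xs : m.-tuple nat)
| NMul (i j : nterm)
| NSum (ys : seq nat) (i : nterm).

Inductive soform (t : voc) :=
| SEq (i j : nterm)
| SNEq (i j : nterm)
| SRel (r : sym t) (xs : (ar r).-tuple nat)
| SNRel (r : sym t) (xs : (ar r).-tuple nat)
| SEqv (x y : nat)
| SNEqv (x y : nat)
| SAnd (phi psi : soform t)
| SOr (phi psi : soform t)
| SEx (x : nat) (phi : soform t)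
| SAll (x : nat) (phi : soform t)
| SExF (m f : nat) (phi : soform t)
| SAllF (m f : nat) (phi : soform t).

Arguments SEq {t}. Arguments SNEq {t}. Arguments SEqv {t}. Arguments SNEqv {t}.

Section SOSemantics.
Variable (R : numFieldType) (t : voc) (S : struc t).
Let A : finType := dom S.

Definition fenv := forall m : nat, nat -> m.-tuple A -> R.

Definition is_dist m (g : m.-tuple A -> R) : Prop :=
  (forall a, 0 <= g a) /\ \sum_a g a = 1.

Definition fupd (fe : fenv) (m f : nat) (g : m.-tuple A -> R) : fenv :=
  fun m' f' =>
    match m =P m' with
    | ReflectT e => if f' == f then ecast n (n.-tuple A -> R) e g else fe m' f'
    | ReflectF _ => fe m' f'
    end.

Arguments fupd fe m f g : clear implicits.

Definition updA (s : nat -> A) (x : nat) (a : A) : nat -> A :=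
  fun y => if y == x then a else s y.

Definition updl (s : nat -> A) (ys : seq nat) (bs : seq A) : nat -> A :=
  fun y => if y \in ys then nth (s y) bs (index y ys) else s y.

Fixpoint neval (s : nat -> A) (fe : fenv) (i : nterm) : R :=
  match i with
  | NF m f xs => fe m f (map_tuple s xs)
  | NMul i j => neval s fe i * neval s fe j
  | NSum ys i => \sum_(b : (size ys).-tuple A) neval (updl s ys b) fe i
  end.

Fixpoint so_sat (s : nat -> A) (fe : fenv) (phi : soform t) : Prop :=
  match phi with
  | SEq i j => neval s fe i = neval s fe j
  | SNEq i j => neval s fe i <> neval s fe j
  | SRel r xs => @interp t S r (map_tuple s xs)
  | SNRel r xs => ~~ @interp t S r (map_tuple s xs)
  | SEqv x y => s x = s y
  | SNEqv x y => s x <> s y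
  | SAnd p q => so_sat s fe p /\ so_sat s fe q
  | SOr p q => so_sat s fe p \/ so_sat s fe q
  | SEx x p => exists a : A, so_sat (updA s x a) fe p
  | SAll x p => forall a : A, so_sat (updA s x a) fe p
  | SExF m f p => exists g : m.-tuple A -> R, is_dist g /\ so_sat s (fupd fe m f g) p
  | SAllF m f p => forall g : m.-tuple A -> R, is_dist g -> so_sat s (fupd fe m f g) p
  end.

(* (A, p^A) |= phi, for phi whose only free variable is the k-ary p
   (named pn); the remaining environment entries are irrelevant. *)
Definition so_holds (k pn : nat) (pA : k.-tuple A -> R) (phi : soform t) : Prop :=
  so_sat (fun _ => pt S) (fupd (fun m _ _ => 0) k pn pA) phi.

(* The team X over {v_1..v_k} (= variables 0..k-1) with X(s) = p^A(s(v)) *)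
Definition team_of (k : nat) (pA : k.-tuple A -> R) : seq ((nat -> dom S) * R) :=
  [seq ((fun v => nth (pt S) (val a) v), pA a) | a <- enum {: k.-tuple A}].

End SOSemantics.

(* fs : allowed function symbols {f_1..f_n, p} (as (arity, name)),
   xs : the universally quantified first-order variables x.          *)
Definition good_atom (fs : seq (nat * nat)) (xs : seq nat) (i j : nterm) : bool :=
  match i, j with
  | NF m1 f1 w, NMul (NF m2 f2 u) (NF m3 f3 v) =>
      [&& val w == val u ++ val v,
          uniq [:: (m1, f1); (m2, f2); (m3, f3)],
          all (fun g => g \in fs) [:: (m1, f1); (m2, f2); (m3, f3)] &
          all (fun y => y \in xs) w]
  | NF m1 f1 u, NSum v (NF m2 f2 w) =>
      [&& val w == val u ++ v, uniq v, all (fun y => y \notin v) u,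
          (m1, f1) != (m2, f2),
          all (fun g => g \in fs) [:: (m1, f1); (m2, f2)] &
          all (fun y => y \in xs) u]
  | _, _ => false
  end.

Fixpoint good_qf t (fs : seq (nat * nat)) (xs : seq nat) (th : soform t) : bool :=
  match th with
  | SEq i j | SNEq i j => good_atom fs xs i j
  | SRel _ ys | SNRel _ ys => all (fun y => y \in xs) ys
  | SEqv x y | SNEqv x y => (x \in xs) && (y \in xs)
  | SAnd a b | SOr a b => good_qf fs xs a && good_qf fs xs b
  | _ => false
  end.

Definition fprefix t (qs : seq (bool * (nat * nat))) (psi : soform t) : soform t :=
  foldr (fun q ps => if q.1 then SExF q.2.1 q.2.2 ps else SAllF q.2.1 q.2.2 ps)
        psi qs.

Definition so_shape t (k pn : nat) (phi : soform t) : Prop :=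
  exists (qs : seq (bool * (nat * nat))) (xs : seq nat) (th : soform t),
    phi = fprefix qs (foldr (@SAll t) th xs) /\
    good_qf ((k, pn) :: [seq q.2 | q <- qs]) xs th.

(* Main.v *)
Require Import Defs.
From HB Require Import structures.
From mathcomp Require Import all_boot all_order all_algebra boolp reals.
Set Implicit Arguments. Unset Strict Implicit. Unset Printing Implicit Defensive.
Import Order.TTheory GRing.Theory Num.Theory.
Local Open Scope ring_scope.

(* Every logical operation of the second-order formula is translated by a
   Boolean one.  A function variable f of arity m becomes a block of m team
   variables whose marginal distribution is f; quantifying f existentially
   quantifies a new block, required to be independent of each earlier block,
   and a universal quantifier is the dual by Boolean negation.  A first-order
   variable becomes a team variable forced to be constant (x independent of
   itself), so that quantifiers over elements are Boolean too.  Once all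
   first-order variables are constant, SUM is a marginal of a block and a
   product is the marginal of a concatenation of two independent blocks; both
   sides of a numerical atom are thus of the form |X_(y=w)| with w constant.
   Finally |X_(y=w)| <= |X_(z=w)| holds iff z has a copy z' (equidistributed
   with it) such that y = w implies z' = w, and this implication is a
   conjunction of disjunctions of literals. *)

(** * Expectations and masses *)

Section Teams.
Variables (R : numFieldType) (t : voc) (S : struc t).
Local Notation A := (dom S).
Local Notation asg := (nat -> A).
Local Notation team := (seq (asg * R)).
Implicit Types (X Y Z : team) (P Q : asg -> bool) (h : asg -> R) (D : seq nat).

Definition expect X h : R := \sum_(e <- X) e.2 * h e.1.

(** The semantics of literals with an arbitrary predicate in place of the literal: [fo_sat] of a
    literal is convertible to an instance. *)
Definition holds X P : bool := all (fun e => (e.2 != 0) ==> P e.1) X.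

(** Fresh variables are allotted in increasing order, so a quantity with this property is untouched
    by whatever is quantified from [N] on. *)
Definition below (T : Type) (N : nat) (h : asg -> T) : Prop :=
  forall s s', (forall v, (v < N)%N -> s v = s' v) -> h s = h s'.

Definition conservative N X X' : Prop :=
  forall P, below N P -> mass X' P = mass X P.

Lemma massE X P : mass X P = expect X (fun s => (P s)%:R).
Proof.
rewrite /mass /expect big_mkcond; apply: eq_bigr => e _.
by case: (P _); rewrite ?mulr1 ?mulr0.
Qed.

Lemma eq_expect X h h' : h =1 h' -> expect X h = expect X h'.
Proof. by move=> hh; apply: eq_bigr => e _; rewrite hh. Qed.

Lemma eq_expect_holds X P h h' :
  holds X P -> (forall s, P s -> h s = h' s) -> expect X h = expect X h'.
Proof.
move=> XP hh; rewrite /expect; elim: X XP => [|e X IH] /=; first by rewrite !big_nil.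
case/andP=> eP XP; rewrite !big_cons IH //; congr (_ + _).
case: (eqVneq e.2 0) eP => [->|_ /= /hh ->] //; by rewrite !mul0r.
Qed.

Lemma eq_mass X P Q : P =1 Q -> mass X P = mass X Q.
Proof. by move=> PQ; apply: eq_bigl => e; rewrite PQ. Qed.

Lemma eq_mass_holds X T P Q :
  holds X T -> (forall s, T s -> P s = Q s) -> mass X P = mass X Q.
Proof. by move=> XT PQ; rewrite !massE; apply: eq_expect_holds XT _ => s /PQ ->. Qed.

Lemma expect_sum (I : finType) X (h : I -> asg -> R) :
  \sum_i expect X (h i) = expect X (fun s => \sum_i h i s).
Proof. by rewrite exchange_big; apply: eq_bigr => e _; rewrite mulr_sumr. Qed.

Lemma expectZ X a h : expect X (fun s => a * h s) = a * expect X h.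
Proof. by rewrite mulr_sumr; apply: eq_bigr => e _; rewrite mulrCA. Qed.

Lemma expectD X h h' : expect X (fun s => h s + h' s) = expect X h + expect X h'.
Proof. by rewrite -big_split; apply: eq_bigr => e _; rewrite mulrDr. Qed.

Lemma holdsW X P Q : (forall s, P s -> Q s) -> holds X P -> holds X Q.
Proof.
by move=> PQ; apply: sub_all => e /implyP eP; apply/implyP => /eP /PQ.
Qed.

Lemma holdsT X P : (forall s, P s) -> holds X P.
Proof. by move=> PT; elim: X => //= e X ->; rewrite PT implybT. Qed.

Lemma holdsI X P Q : holds X (fun s => P s && Q s) = holds X P && holds X Q.
Proof.
rewrite /holds -all_predI; apply: eq_all => e /=.
by case: (_ == 0); case: (P _); case: (Q _).
Qed.

Lemma team_ge0 X : is_team X -> all (fun e => 0 <= e.2) X.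
Proof. by case. Qed.

Lemma expect_ge0 X h : is_team X -> (forall s, 0 <= h s) -> 0 <= expect X h.
Proof.
case=> + _ h0; rewrite /expect; elim: X => [|e X IH] /=; first by rewrite big_nil.
by case/andP=> e0 /IH ?; rewrite big_cons addr_ge0 // mulr_ge0.
Qed.

Lemma expect1 X : is_team X -> expect X (fun=> 1) = 1.
Proof. by case=> _ X1; rewrite -[RHS]X1; apply: eq_bigr => e _; rewrite mulr1. Qed.

Lemma mass_ge0 X P : is_team X -> 0 <= mass X P.
Proof. by move=> HX; rewrite massE expect_ge0. Qed.

Lemma mass_true X P : is_team X -> (forall s, P s) -> mass X P = 1.
Proof. by move=> HX PT; rewrite massE -[RHS](expect1 HX); apply: eq_expect => s; rewrite PT. Qed.

Lemma mass_split X P Q :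
  mass X P = mass X (fun s => P s && Q s) + mass X (fun s => P s && ~~ Q s).
Proof.
rewrite !massE -expectD; apply: eq_expect => s.
by case: (P s); case: (Q s); rewrite /= ?addr0 ?add0r.
Qed.

Lemma mass_sub X P Q : is_team X -> (forall s, P s -> Q s) -> mass X P <= mass X Q.
Proof.
move=> HX PQ; rewrite [leRHS](mass_split _ _ P).
rewrite (@eq_mass X (fun s => Q s && P s) P); last first.
  by move=> s; case: (boolP (P s)) => [/PQ ->|]; rewrite ?andbF.
by rewrite lerDl mass_ge0.
Qed.

Lemma mass_sub_holds X T P Q : is_team X -> holds X T ->
  (forall s, T s -> P s -> Q s) -> mass X P <= mass X Q.
Proof.
move=> HX XT PQ; rewrite (@eq_mass_holds X T P (fun s => T s && P s)) //; last first.
  by move=> s ->.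
by apply: mass_sub => // s /andP[]; apply: PQ.
Qed.

Lemma mass_compl X P : is_team X -> mass X P + mass X (fun s => ~~ P s) = 1.
Proof.
by move=> HX; rewrite -(mass_true HX (P := xpredT)) // [RHS](mass_split _ _ P).
Qed.

(** Weights are nonnegative, so a sum of them vanishes only if each of them does. *)
Lemma holds_mass X P : is_team X -> holds X P = (mass X (fun s => ~~ P s) == 0).
Proof.
case=> + _; rewrite /holds /mass; elim: X => [|e X IH] /=; first by rewrite big_nil eqxx.
case/andP=> e0 X0; rewrite big_cons (IH X0); case: (P _) => /=; first by rewrite implybT.
rewrite implybF negbK paddr_eq0 //; elim: X X0 {IH} => [|e' X IH] /=; first by rewrite big_nil.
by case/andP=> ? /IH ?; rewrite big_cons; case: ifP => //; rewrite addr_ge0.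
Qed.

Lemma holds_mass1 X P : is_team X -> holds X P = (mass X P == 1).
Proof.
move=> HX; rewrite holds_mass // -(mass_compl P HX).
by rewrite -[X in _ = (X == _)]addr0 (inj_eq (addrI _)) eq_sym.
Qed.

Lemma holds_conservative N X X' P : is_team X -> is_team X' ->
  conservative N X X' -> below N P -> holds X' P = holds X P.
Proof. by move=> HX HX' XX' PN; rewrite !holds_mass1 // XX'. Qed.

Lemma holds_nonempty X P : is_team X -> holds X P -> exists s, P s.
Proof.
move=> HX; rewrite holds_mass1 // => /eqP X1.
apply: contrapT => nP; move: X1; rewrite (@eq_mass _ _ xpred0).
  by rewrite /mass big_pred0_eq => /esym/eqP; rewrite oner_eq0.
by move=> s; apply/negP => Ps; apply: nP; exists s.
Qed.

(* Locating the i-th entry of X from its position is what lets a kernel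
   depending on the assignment be fed to [supp_ext]. *)
Lemma sum_zip_iota (d : asg * R) X (g : nat -> asg * R -> R) :
  \sum_(e <- zip (iota 0 (size X)) X) g e.1 e.2 =
  \sum_(0 <= i < size X) g i (nth d X i).
Proof.
rewrite (big_nth (0%N, d)) size_zip size_iota minnn.
apply: eq_big_nat => i /andP[_ iX].
by rewrite nth_zip ?size_iota // nth_iota.
Qed.

(** An extension never reads this default: the positions paired with the entries of [X] stay below
    [size X]. *)
Let dflt : asg * R := ((fun=> pt S), 0).

Lemma expect_supp_ext X x F h :
  expect (supp_ext X x F) h =
  \sum_(0 <= i < size X) (nth dflt X i).2 *
     \sum_a F i a * h (upd (nth dflt X i).1 x a).
Proof.
rewrite /expect /supp_ext big_flatten big_map.
under eq_bigr do rewrite big_map.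
rewrite (sum_zip_iota dflt X (fun i e => \sum_(a <- enum A)
  (upd e.1 x a, e.2 * F i a).2 * h (upd e.1 x a, e.2 * F i a).1)).
apply: eq_bigr => i _ /=; rewrite mulr_sumr big_enum /=.
by apply: eq_bigr => a _; rewrite mulrA.
Qed.

Lemma expect_supp_ext_kernel X x (K : asg -> A -> R) h :
  expect (supp_ext X x (fun i => K (nth dflt X i).1)) h =
  expect X (fun s => \sum_a K s a * h (upd s x a)).
Proof. by rewrite expect_supp_ext [RHS](big_nth dflt). Qed.

(** Each [F i] has total mass 1 and [h] does not look at [x], so the new coordinate sums out. *)
Lemma expect_supp_ext_below N X x F h :
  (forall i, (i < size X)%N -> is_distA (F i)) -> (N <= x)%N -> below N h ->
  expect (supp_ext X x F) h = expect X h.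
Proof.
move=> HF Nx hN; rewrite expect_supp_ext [RHS](big_nth dflt).
apply: eq_big_nat => i /andP[_ /HF[_ F1]]; congr (_ * _).
rewrite -[RHS]mul1r -F1 mulr_suml; apply: eq_bigr => a _; congr (_ * _).
by apply: hN => v vN; rewrite /upd ifN // neq_ltn (leq_trans vN Nx).
Qed.

Lemma is_team_supp_ext X x F :
  (forall i, (i < size X)%N -> is_distA (F i)) -> is_team X ->
  is_team (supp_ext X x F).
Proof.
move=> HF HX; split; last first.
  have := @expect_supp_ext_below 0 X x F (fun=> 1) HF (leq0n _) (fun _ _ _ => erefl).
  rewrite (expect1 HX) => E; rewrite -[RHS]E; apply: eq_bigr => e _.
  by rewrite mulr1.
have all_flatten (ss : seq team) p : all (all p) ss -> all p (flatten ss).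
  by elim: ss => //= r ss IH /andP[rp /IH]; rewrite all_cat rp.
apply: all_flatten; rewrite all_map; apply/(all_nthP (0%N, dflt)) => i.
rewrite size_zip size_iota minnn => iX /=.
rewrite nth_zip ?size_iota // nth_iota //= all_map; apply/allP => a _ /=.
rewrite mulr_ge0 ?(HF _ iX).1 //.
by have /(all_nthP dflt)/(_ i iX) := team_ge0 HX.
Qed.

End Teams.

(** * Extending a team by a block of variables *)

Definition FExs t (xs : seq nat) (phi : fo t) : fo t := foldr (@FEx t) phi xs.

Lemma sum_cons_tuple (R : nmodType) (A : finType) m (f : seq A -> R) :
  \sum_(u : m.+1.-tuple A) f u = \sum_a \sum_(u : m.-tuple A) f (a :: u).
Proof.
rewrite pair_big /=.
rewrite (reindex (fun p : A * m.-tuple A => cons_tuple p.1 p.2)) //.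
exists (fun u => (thead u, behead_tuple u)) => [[a u] _ | u _] /=.
  by congr (_, _); apply: val_inj.
by rewrite [RHS]tuple_eta; apply: val_inj.
Qed.

Lemma sum_indic_tuple (R : pzSemiRingType) (A : finType) m (a : m.-tuple A) (f : seq A -> R) :
  \sum_(u : m.-tuple A) (val u == val a)%:R * f u = f a.
Proof.
rewrite (bigD1 a) //= eqxx mul1r big1 ?addr0 // => u ua.
by rewrite (inj_eq val_inj) (negbTE ua) mul0r.
Qed.

Section Blocks.
Variables (R : numFieldType) (t : voc) (S : struc t).
Local Notation A := (dom S).
Local Notation asg := (nat -> A).
Local Notation team := (seq (asg * R)).
Implicit Types (X Y Z : team) (P Q : asg -> bool) (h : asg -> R) (D : seq nat).

(** The default [s v] leaves the variables from [N + size u] on unchanged. *)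
Definition write N (u : seq A) (s : asg) : asg :=
  fun v => if (v < N)%N then s v else nth (s v) u (v - N).

Lemma write_cons N a u s : write N (a :: u) s = write N.+1 u (upd s N a).
Proof.
apply: funext => v; rewrite /write /upd.
case: (ltngtP v N) => [vN|vN|->]; first by rewrite (ltnW vN : (v < N.+1)%N).
  by rewrite ltnNge vN /= -(subnSK vN).
by rewrite ltnSn subnn.
Qed.

Lemma write_nil N s : write N [::] s = s.
Proof. by apply: funext => v; rewrite /write nth_nil if_same. Qed.

Lemma map_write N u s : map (write N u s) (iota N (size u)) = u.
Proof.
apply: (@eq_from_nth _ (pt S)) => [|i]; rewrite size_map size_iota // => iu.
rewrite (nth_map 0%N) ?size_iota // nth_iota // /write.
by rewrite ltnNge leq_addr /= addKn; apply: set_nth_default.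
Qed.

Lemma write_below (T : Type) N u s (h : asg -> T) : below N h -> h (write N u s) = h s.
Proof. by move=> hN; apply: hN => v vN; rewrite /write vN. Qed.

Lemma belowW (T : Type) N M (h : asg -> T) : (N <= M)%N -> below N h -> below M h.
Proof. by move=> NM hN s s' ss'; apply: hN => v vN; apply: ss'; apply: leq_trans vN NM. Qed.

(** All that is ever extracted from a satisfied block of quantifiers: whatever the kernels were,
    they only set variables from [N] on, so no law below [N] changes. *)
Lemma FExs_elim N xs (phi : fo t) D X :
  all (leq N) xs -> is_team X -> fo_sat D X (FExs xs phi) ->
  exists X', [/\ is_team X', conservative N X X' & fo_sat (catrev xs D) X' phi].
Proof.
elim: xs D X => [|x xs IH] D X /=; first by move=> _ HX ?; exists X; split.
case/andP=> Nx Nxs HX [F [HF /(IH _ _ Nxs (is_team_supp_ext x HF HX))]].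
case=> X' [HX' XX' sat]; exists X'; split=> // P PN.
rewrite XX' // !massE; apply: expect_supp_ext_below HF Nx _ => s s' ss'.
by rewrite (PN s s').
Qed.

(* The kernel G prescribes the law of the whole block; the law of its first
   variable is the marginal, the later ones get the conditional laws. *)
Lemma FExs_intro N m (phi : fo t) D X (G : asg -> seq A -> R) :
  (forall s u, 0 <= G s u) -> (forall s, \sum_(u : m.-tuple A) G s u = 1) ->
  (forall u, below N (fun s => G s u)) -> is_team X ->
  (forall X', is_team X' ->
     (forall P, mass X' P =
        expect X (fun s => \sum_(u : m.-tuple A) G s u * (P (write N u s))%:R)) ->
     fo_sat (catrev (iota N m) D) X' phi) ->
  fo_sat D X (FExs (iota N m) phi).
Proof.
elim: m N D X G => [|m IH] N D X G G0 G1 GN HX H /=.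
  apply: H => // P; rewrite massE; apply: eq_expect => s.
  have sum0 (f : seq A -> R) : \sum_(u : 0.-tuple A) f u = f [::].
    by rewrite (bigD1 [tuple]) //= big1 ?addr0 // => u /eqP[]; apply: val_inj; case: u => -[].
  rewrite (sum0 (fun u => G s u * (P (write N u s))%:R)) write_nil.
  by rewrite -(sum0 (G s)) G1 mul1r.
pose K s a := \sum_(u : m.-tuple A) G s (a :: u).
have K0 s a : 0 <= K s a by apply: sumr_ge0.
have KN a : below N (fun s => K s a).
  by move=> s s' ss'; apply: eq_bigr => u _; apply: GN.
(* [G'] is the conditional law of the remaining variables given the value just stored at [N]. Where
   that value has probability 0 any law will do, and a point mass is taken. *)
pose G' s u := if K s (s N) == 0 then (u == nseq m (pt S))%:R
               else G s (s N :: u) / K s (s N).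
exists (fun i => K (nth ((fun=> pt S), 0) X i).1).
have HF i : (i < size X)%N -> is_distA (K (nth ((fun=> pt S), 0) X i).1).
  by move=> _; split=> //; rewrite -[RHS](G1 (nth ((fun=> pt S), 0) X i).1) sum_cons_tuple.
split=> //; apply: (IH _ _ _ G').
- by move=> s u; rewrite /G'; case: ifP => _; rewrite ?ler0n // divr_ge0.
- move=> s; rewrite /G'; case: (boolP (K s (s N) == 0)) => K_0; last first.
    by rewrite -mulr_suml divff.
  rewrite -[RHS](sum_indic_tuple (nseq_tuple m (pt S)) (fun=> 1)).
  by apply: eq_bigr => u _; rewrite mulr1.
- move=> u s s' ss'; have sN := ss' N (ltnSn N).
  have ss'' v : (v < N)%N -> s v = s' v by move=> vN; apply/ss'/ltnW.
  by rewrite /G' -sN (KN _ _ _ ss'') (GN _ _ _ ss'').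
- exact: is_team_supp_ext.
move=> X' HX' massX'; apply: H => // P; rewrite massX' expect_supp_ext_kernel.
apply: eq_expect => s.
rewrite (sum_cons_tuple _ (fun u => G s u * (P (write N u s))%:R)).
apply: eq_bigr => a _.
have updN : upd s N a N = a by rewrite /upd eqxx.
have upd_lt v : (v < N)%N -> upd s N a v = s v.
  by move=> vN; rewrite /upd ltn_eqF.
rewrite mulr_sumr; apply: eq_bigr => u _; rewrite write_cons mulrA; congr (_ * _).
rewrite /G' updN (KN _ _ _ upd_lt) (GN _ _ _ upd_lt).
case: ifPn => [/eqP K_0|K_0]; last by rewrite mulrC divfK.
(* A null first value makes every nonnegative summand [G s (a :: u)] vanish, so both sides are 0
   despite the arbitrary choice in [G']. *)
rewrite K_0 mul0r; move/eqP: K_0; rewrite psumr_eq0 // => /allP/(_ u).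
by rewrite mem_index_enum => /(_ isT)/eqP.
Qed.

Lemma kernel_below N m (G : asg -> seq A -> R) X X' :
  (forall s, \sum_(u : m.-tuple A) G s u = 1) ->
  (forall P, mass X' P =
        expect X (fun s => \sum_(u : m.-tuple A) G s u * (P (write N u s))%:R)) ->
  conservative N X X'.
Proof.
move=> G1 massX' P PN; rewrite massX' massE; apply: eq_expect => s.
under eq_bigr do rewrite (write_below _ _ PN).
by rewrite -mulr_suml G1 mul1r.
Qed.

(** Of all the tuples [u] that may be written only [u = a] meets the event, and [Q] does not see the
    block. *)
Lemma kernel_block N m (G : asg -> seq A -> R) X X' (a : m.-tuple A) Q :
  (forall P, mass X' P =
        expect X (fun s => \sum_(u : m.-tuple A) G s u * (P (write N u s))%:R)) ->
  below N Q ->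
  mass X' (fun s => (map s (iota N m) == val a) && Q s) =
  expect X (fun s => G s (val a) * (Q s)%:R).
Proof.
move=> massX' QN; rewrite massX'; apply: eq_expect => s.
rewrite -[RHS](sum_indic_tuple a (fun u => G s u * (Q s)%:R)).
apply: eq_bigr => u _; rewrite (write_below _ _ QN).
have := map_write N u s; rewrite size_tuple => ->.
by case: eqP; rewrite /= ?mul1r // mul0r mulr0.
Qed.

(** * Flat formulas and the splitting disjunction *)

Definition flat D (phi : fo t) P : Prop :=
  forall X, is_team X -> (fo_sat D X phi <-> holds X P).

Definition depends D P : Prop := forall s s', {in D, s =1 s'} -> P s = P s'.

Lemma agreeP D (s s' : asg) : reflect {in D, s' =1 s} (agree D s s').
Proof. by apply: (iffP eqP) => [/eq_in_map|/eq_in_map]. Qed.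

Lemma mass_mix k Y Z P : mass (mix k Y Z) P = k * mass Y P + (1 - k) * mass Z P.
Proof. by rewrite /mass /mix big_cat !big_map /= !mulr_sumr. Qed.

Lemma mass_scale k X P :
  mass [seq (e.1, k * e.2) | e <- X] P = k * mass X P.
Proof. by rewrite /mass big_map /= mulr_sumr. Qed.

Lemma mass_filter X P Q :
  mass [seq e <- X | P e.1] Q = mass X (fun s => Q s && P s).
Proof. by rewrite /mass big_filter_cond; apply: eq_bigl => e; rewrite andbC. Qed.

Lemma team_mass_true X : mass X xpredT = \sum_(e <- X) e.2.
Proof. by []. Qed.

(** If [P] reads only [D] and fails at [s], it fails on the whole class of [s] modulo [D]. A
    splitting of a team is specified only through the masses of such classes. *)
Lemma all_mass0 X P : holds X P -> forall s D, depends D P -> ~~ P s ->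
  mass X (agree D s) = 0.
Proof.
move=> XP s D PD Ps; rewrite (@eq_mass_holds _ _ _ _ _ _ xpred0 XP).
  by rewrite /mass big_pred0_eq.
by move=> s' Ps'; apply: contraNF Ps => /agreeP ss'; rewrite (PD _ s') // => v /ss'.
Qed.

(** [Y] is [X] conditioned on [P]. For a null [P] it is a point mass at a witness of [T], and the
    equation, being free of division, reads 0 = 0. *)
Lemma exists_conditional X P (T : asg -> bool) : is_team X -> (exists s, T s) ->
  holds X (fun s => P s ==> T s) ->
  exists Y, [/\ is_team Y, holds Y T &
    forall Q, mass X P * mass Y Q = mass X (fun s => Q s && P s)].
Proof.
move=> HX [s Ts] PT; have [XP0|XP0] := eqVneq (mass X P) 0.
  exists [:: (s, 1)]; split=> [||Q]; rewrite /is_team /holds /= ?ler01 ?Ts ?implybT //.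
    by split=> //; rewrite big_seq1.
  rewrite XP0 mul0r; apply/esym/eqP; rewrite eq_le mass_ge0 // andbT -XP0.
  by apply: mass_sub => // s' /andP[].
pose Y : team := [seq (e.1, (mass X P)^-1 * e.2) | e <- [seq e <- X | P e.1]].
have YQ Q : mass Y Q = (mass X P)^-1 * mass X (fun s => Q s && P s).
  by rewrite mass_scale mass_filter.
exists Y; split=> [||Q]; last by rewrite YQ mulVKf.
  split; last by rewrite -team_mass_true YQ /= mulVf.
  rewrite all_map all_filter; apply: sub_all (team_ge0 HX) => e e0 /=.
  by apply/implyP => _; rewrite mulr_ge0 // invr_ge0 mass_ge0.
rewrite /holds all_map all_filter; apply: sub_all PT => e /=.
by case: (P _) => //=; rewrite mulf_eq0 invr_eq0 (negbTE XP0).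
Qed.

Lemma weight_le_mass d X P i : is_team X -> (i < size X)%N ->
  P (nth d X i).1 -> (nth d X i).2 <= mass X P.
Proof.
case=> + _; rewrite /mass; elim: X i => //= e X IH i /andP[e0 X0].
have mass0 Y : all (fun e => 0 <= e.2) Y -> 0 <= \sum_(e <- Y | P e.1) e.2.
  elim: Y => [|e' Y IHY] /=; first by rewrite big_nil.
  by case/andP=> ? /IHY ?; rewrite big_cons; case: ifP => //; rewrite addr_ge0.
case: i => [_ /= Pe|i]; first by rewrite big_cons Pe lerDl mass0.
rewrite ltnS => iX /= /(IH _ X0 iX) le_i; rewrite big_cons; case: ifP => // _.
by rewrite (le_trans le_i) // lerDr.
Qed.

(* The split of a disjunction has no empty part, even when its weight is 0:
   this is why both disjuncts must be satisfiable. *)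
Lemma flat_or D phi psi P Q :
  flat D phi P -> flat D psi Q -> depends D P -> depends D Q ->
  (exists s, P s) -> (exists s, Q s) ->
  flat D (FOr phi psi) (fun s => P s || Q s).
Proof.
move=> fP fQ dP dQ sP sQ X HX; split=> /=.
  move=> [Y [Z [k [HY [HZ [_ [XYZ [/fP-/(_ HY) YP /fQ-/(_ HZ) ZQ]]]]]]]].
  have H0 s : ~~ (P s || Q s) -> mass X (agree D s) = 0.
    rewrite negb_or => /andP[nP nQ].
    by rewrite XYZ mass_mix (all_mass0 YP) // (all_mass0 ZQ) // !mulr0 addr0.
  have [d _] : exists d : asg * R, True by exists (fun=> pt S, 0).
  apply/(all_nthP d) => i iX; apply/implyP; apply: contra_neqT => /H0 X0.
  (* An entry weighs at most as much as its class modulo [D], and that class is null. *)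
  apply/eqP; rewrite eq_le (all_nthP d (team_ge0 HX)) // andbT -X0.
  by apply: weight_le_mass => //; apply/agreeP.
move=> XPQ.
(* The two parts are [X] conditioned on [P] and on its complement, mixed with weight [mass X P]. *)
have [|Y [HY YP massY]] := exists_conditional (P := P) HX sP.
  by apply: holdsT => s; apply: implybb.
have [|Z [HZ ZQ massZ]] := exists_conditional (P := fun s => ~~ P s) HX sQ.
  by apply: holdsW XPQ => s; case: (P s).
have XP := mass_compl P HX.
exists Y, Z, (mass X P); do 2![split=> //]; split.
  by rewrite mass_ge0 //= -XP lerDl mass_ge0.
split; last by split; [apply/fP|apply/fQ].
by move=> s; rewrite mass_mix massY -XP [X in (X - _) * _]addrC addrK massZ -mass_split.
Qed.

End Blocks.

(** * Comparing masses at a constant point *)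

Section Formulas.
Variable t : voc.

(** The syntax has no constant for truth; equidistribution of the empty tuple with itself serves as
    one. *)
Definition ftrue : fo t := @FApprox t 0 [tuple] [tuple].

(** The implication from all equations in [ps] to the equation [q], in disjunctive form. *)
Definition clause (ps : seq (nat * nat)) (q : nat * nat) : fo t :=
  foldr (fun p phi => FOr (FNEq p.1 p.2) phi) (FEq q.1 q.2) ps.

(** The implication from [y = w] to [z = w] in conjunctive form, with one clause per coordinate of
    [z]. *)
Definition fimpl (y z w : seq nat) : fo t :=
  foldr (fun q phi => FAnd (clause (zip y w) q) phi) ftrue (zip z w).

(* For constant w, |X_(y=w)| <= |X_(z=w)| holds exactly when z has a copy z'
   that equals w whenever y does. *)
Definition mass_le (N : nat) (y z w : seq nat) : fo t :=
  FExs (iota N (size z))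
    (FAnd (@FApprox t (size z) (in_tuple z) (iota_tuple (size z) N))
          (fimpl y (iota N (size z)) w)).

Definition two_elements (N : nat) : fo t := FExs (iota N 2) (FNEq N N.+1).

(* On a one-element structure the literals y <> w of the clauses are
   unsatisfiable, but both masses equal 1. *)
Definition mass_eq (N : nat) (y z w : seq nat) : fo t :=
  FNeg (FAnd (two_elements N) (FNeg (FAnd (mass_le N y z w) (mass_le N z y w)))).

Definition is_const (x : nat) : fo t := FCInd [::] [:: x] [:: x].

End Formulas.

Lemma mem_zip (T U : eqType) (u : seq T) (v : seq U) r :
  r \in zip u v -> (r.1 \in u) /\ (r.2 \in v).
Proof.
elim: u v => [|u0 u IHu] [|v0 v] //=; rewrite !inE => /orP[/eqP->|/IHu[-> ->]].
  by rewrite !eqxx.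
by rewrite !orbT.
Qed.

Lemma eq_map_zip (T : eqType) (s : nat -> T) y w : size y = size w ->
  (map s y == map s w) = all (fun p => s p.1 == s p.2) (zip y w).
Proof.
elim: y w => [|v y IH] [|v' w] //= [/IH yw].
by rewrite eqseq_cons yw.
Qed.

Section Semantics.
Variables (R : numFieldType) (t : voc) (S : struc t).
Local Notation A := (dom S).
Local Notation asg := (nat -> A).
Local Notation team := (seq (asg * R)).
Implicit Types (X Y Z : team) (P Q : asg -> bool) (h : asg -> R) (D : seq nat).

Lemma eq_flat D (phi : fo t) P Q : P =1 Q -> flat R D phi P -> flat R D phi Q.
Proof. by move=> /funext ->. Qed.

Lemma flat_true D : flat R D (ftrue t) (fun _ : asg => true).
Proof.
by move=> X _; split=> [_|_ a]; [exact: holdsT | apply: eq_mass => s].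
Qed.

(** [flat_or] wants both disjuncts satisfiable. An inequality between distinct variables is, given
    two elements; the rest of the clause holds under a constant assignment through its final
    equation. *)
Lemma flat_clause D ps q :
  {subset flatten [seq [:: p.1; p.2] | p <- q :: ps] <= D} ->
  all (fun p => p.1 != p.2) ps -> (exists a b : A, a != b) ->
  flat R D (clause t ps q)
    (fun s : asg => has (fun p => s p.1 != s p.2) ps || (s q.1 == s q.2)).
Proof.
move=> + + [a [b ab]]; elim: ps => [|p ps IH] //= qD /andP[pp pps].
apply: (@eq_flat _ _ (fun s : asg => (s p.1 != s p.2) ||
  (has (fun p => s p.1 != s p.2) ps || (s q.1 == s q.2)))).
  by move=> s; rewrite orbA.
have qD1 : q.1 \in D by apply: qD; rewrite inE eqxx.
have qD2 : q.2 \in D by apply: qD; rewrite !inE eqxx orbT.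
have pD1 : p.1 \in D by apply: qD; rewrite !inE eqxx !orbT.
have pD2 : p.2 \in D by apply: qD; rewrite !inE eqxx !orbT.
have qpsD : {subset flatten [seq [:: p.1; p.2] | p <- q :: ps] <= D}.
  move=> v /=; rewrite !inE => /or3P[/eqP->|/eqP->|vps] //.
  by apply: qD; rewrite !inE vps !orbT.
apply: flat_or => //; first exact: IH.
- by move=> s s' ss'; rewrite !ss'.
- move=> s s' ss'; rewrite !ss' //; congr (_ || _); apply: eq_in_has => r rps.
  have rD v : v \in [:: r.1; r.2] -> v \in D.
    move=> vr; apply: qpsD => /=; rewrite !inE; apply/orP; right; apply/orP; right.
    by apply/flattenP; exists [:: r.1; r.2] => //; apply: map_f.
  by rewrite !ss' // rD // !inE eqxx ?orbT.
- by exists (fun v => if v == p.1 then a else b); rewrite eqxx [p.2 == _]eq_sym (negbTE pp).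
- by exists (fun=> a); rewrite eqxx orbT.
Qed.

(** Disjointness of [y] from [w] makes the two variables of each premise distinct, as [flat_clause]
    requires. *)
Lemma flat_fimpl D y z w : size y = size w -> size z = size w ->
  {subset y ++ z ++ w <= D} -> all (fun v => v \notin w) y ->
  (exists a b : A, a != b) ->
  flat R D (fimpl t y z w)
    (fun s : asg => (map s y == map s w) ==> (map s z == map s w)).
Proof.
move=> yw zw yzwD y_w ab; rewrite /fimpl.
apply: (@eq_flat _ _ (fun s : asg => 
  all (fun q => has (fun p => s p.1 != s p.2) (zip y w) || (s q.1 == s q.2)) (zip z w))).
  move=> s; rewrite !eq_map_zip //.
  have -> : has (fun p : nat * nat => s p.1 != s p.2) (zip y w) =
      ~~ all (fun p : nat * nat => s p.1 == s p.2) (zip y w) by rewrite -has_predC.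
  by case: (all _ (zip y w)) => //=; apply/all_predT.
(* Only the list of conclusions is generalised for the induction; the premises [zip y w] stay fixed,
   and the inclusion remembers where each conclusion comes from. *)
have : {subset zip z w <= zip z w} by [].
elim: {1 3 4}(zip z w) => [|q qs IH] qzw /=; first exact: flat_true.
have qsD : {subset qs <= zip z w} by move=> r rqs; apply: qzw; rewrite inE rqs orbT.
have {}IH := IH qsD.
have [q1 q2] := mem_zip (qzw q (mem_head _ _)).
have Cl : flat R D (clause t (zip y w) q)
    (fun s : asg => has (fun p => s p.1 != s p.2) (zip y w) || (s q.1 == s q.2)).
  apply: flat_clause => //.
    move=> v /flattenP[_ /mapP[r rq ->]] vr.
    suff [r1 r2] : r.1 \in D /\ r.2 \in D by move: vr; rewrite !inE => /orP[]/eqP->.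
    move: rq; rewrite inE => /orP[/eqP->|/mem_zip[r1 r2]];
      by split; apply: yzwD; rewrite !mem_cat ?q1 ?q2 ?r1 ?r2 ?orbT.
  apply/allP => r /mem_zip[/(allP y_w) r1 r2].
  by apply: contraNneq r1 => ->.
move=> X HX; rewrite holdsI /=; split=> [[HC Hqs]|/andP[HC Hqs]].
  by apply/andP; split; [apply/(Cl X) | apply/(IH X)].
by split; [apply/(Cl X) | apply/(IH X)].
Qed.

(** The law of total probability over the values of [y]; in SUM atoms it absorbs the summed
    arguments. *)
Lemma sum_mass n X (y : seq nat) Q : size y = n ->
  \sum_(a : n.-tuple A) mass X (fun s => (map s y == val a) && Q s) = mass X Q.
Proof.
move=> yn; under eq_bigr do rewrite massE.
rewrite expect_sum massE; apply: eq_expect => s.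
have sy : size (map s y) == n by rewrite size_map yn.
rewrite (bigD1 (Tuple sy)) //= eqxx big1 ?addr0 // => a.
by rewrite -val_eqE /= eq_sym => /negbTE ->.
Qed.

Lemma sat_two_elements N D X : is_team X ->
  fo_sat D X (two_elements t N) <-> exists a b : A, a != b.
Proof.
move=> HX; split.
  move/FExs_elim => /(_ N)[|//|X' [HX' _ sat]]; first by rewrite /= leqnn leqnSn.
  have [s ss] := holds_nonempty (P := fun s => s N != s N.+1) HX' sat.
  by exists (s N), (s N.+1).
move=> [a [b ab]].
have G1 (s : asg) : \sum_(u : 2.-tuple A) ((val u == [:: a; b])%:R : R) = 1.
  rewrite -[RHS](sum_indic_tuple [tuple a; b] (fun=> 1)).
  by apply: eq_bigr => u _; rewrite mulr1.
apply: (@FExs_intro _ _ _ _ _ _ _ _ (fun _ u => (u == [:: a; b])%:R)) => //.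
move=> X' HX' massX' /=.
rewrite -/(holds X' (fun s => s N != s N.+1)) holds_mass1 // massX'.
apply/eqP; rewrite -[RHS](expect1 HX); apply: eq_expect => s.
rewrite (sum_indic_tuple [tuple a; b] (fun u => (write N u s N != write N u s N.+1)%:R)).
by rewrite /write ltnn ltnNge leqnSn subnn subSnn /= ab.
Qed.

Lemma mass_approx X n (y z : seq nat) :
  (forall a : n.-tuple A,
     mass X (fun s => map s y == val a) = mass X (fun s => map s z == val a)) ->
  forall c : seq A, size c = n ->
  mass X (fun s => map s y == c) = mass X (fun s => map s z == c).
Proof. by move=> yz c cn; have := yz (tcast cn (in_tuple c)); rewrite /= val_tcast. Qed.

Lemma below_map N (y : seq nat) (c : seq A) :
  all (fun v => v < N)%N y -> below N (fun s => map s y == c).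
Proof.
by move=> yN s s' ss'; congr (_ == _); apply/eq_in_map => v /(allP yN)/ss'.
Qed.

(** The converse builds a coupling: the copy of [z] is set to [c] where [y] equals [c], and
    elsewhere it is drawn so that its overall law is that of [z]. The inequality says that [z] has
    enough mass at [c] for this. *)
Lemma sat_mass_le N D X y z w (c : seq A) :
  is_team X -> size y = size w -> size z = size w ->
  all (fun v => v < N)%N (y ++ z ++ w) -> all (fun v => v \notin w) y ->
  {subset iota 0 N <= D} -> (exists a b : A, a != b) ->
  holds X (fun s => map s w == c) ->
  fo_sat D X (mass_le t N y z w) <->
  mass X (fun s => map s y == c) <= mass X (fun s => map s z == c).
Proof.
move=> HX yw zw; rewrite !all_cat => /and3P[yN zN wN] y_w DN ab Xw.
set n := size z; set z' := iota N n.
have cn : size c = n.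
  by have [s /eqP <-] := holds_nonempty HX Xw; rewrite size_map -zw.
have subD : {subset y ++ z' ++ w <= catrev z' D}.
  move=> v; rewrite catrevE !mem_cat mem_rev => /or3P[vy|->//|vw].
    by rewrite [v \in D]DN ?orbT // mem_iota (allP yN).
  by rewrite [v \in D]DN ?orbT // mem_iota (allP wN).
have z'w : size z' = size w by rewrite size_iota.
have fl := flat_fimpl yw z'w subD y_w ab.
split.
  move/FExs_elim => /(_ N)[|//|X' [HX' XX' /= [zz' /fl-/(_ HX') yz']]].
    by apply/allP => v; rewrite mem_iota => /andP[].
  have Xw' : holds X' (fun s => map s w == c).
    by rewrite (holds_conservative HX HX' XX') //; apply: below_map.
  rewrite -(XX' _ (below_map c yN)) -(XX' _ (below_map c zN)).
  rewrite (mass_approx zz' cn) /=; apply: (mass_sub_holds HX'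
    (T := fun s => (map s w == c) && ((map s y == map s w) ==> (map s z' == map s w)))).
    by rewrite holdsI Xw'.
  by move=> s /andP[/eqP ->] /implyP.
move=> le_yz.
set mu := mass X (fun s => map s y == c).
pose ctup : n.-tuple A := tcast cn (in_tuple c).
have cE : val ctup = c by rewrite /ctup /= val_tcast.
pose nu (u : seq A) := mass X (fun s => map s z == u).
have sum_nu : \sum_(u : n.-tuple A) nu u = 1.
  rewrite -(mass_true HX (P := xpredT)) // -(sum_mass X xpredT (erefl n)).
  by apply: eq_bigr => u _; apply: eq_mass => s; rewrite andbT.
have sum_c (f : seq A -> R) : \sum_(u : n.-tuple A) (val u == c)%:R * f u = f c.
  by rewrite -cE sum_indic_tuple.
(* What is left of the law of [z] once mass [mu] has been spent at [c]; at [c] it is nonnegative by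
   [le_yz]. *)
pose eta u := nu u - mu * (u == c)%:R.
have eta0 u : 0 <= eta u.
  rewrite subr_ge0; case: eqP => [->|_]; first by rewrite mulr1.
  by rewrite mulr0 mass_ge0.
have sum_eta : \sum_(u : n.-tuple A) eta u = 1 - mu.
  rewrite sumrB sum_nu -mulr_sumr -[in RHS](mulr1 mu); congr (_ - _ * _).
  by rewrite -[RHS](sum_c (fun=> 1)); apply: eq_bigr => u _; rewrite mulr1.
have mu1 : 0 <= 1 - mu by rewrite -sum_eta sumr_ge0.
(* The remainder, normalised. If [mu = 1], the event that [y] differs from [c] is null and the law
   chosen on it is immaterial. *)
pose nu' u := if mu == 1 then (u == c)%:R else eta u / (1 - mu).
have nu'E (u : n.-tuple A) : (1 - mu) * nu' u = eta u.
  rewrite /nu'; case: eqP => [mu_1|/eqP mu_1].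
    rewrite mu_1 subrr mul0r; move/eqP: sum_eta; rewrite mu_1 subrr psumr_eq0 //.
    by move=> /allP/(_ u); rewrite mem_index_enum => /(_ isT)/eqP.
  by rewrite mulrC divfK // subr_eq0 eq_sym.
pose G (s : asg) u := if map s y == c then (u == c)%:R else nu' u.
have G1 s : \sum_(u : n.-tuple A) G s u = 1.
  have c1 : \sum_(u : n.-tuple A) (val u == c)%:R = 1 :> R.
    by rewrite -[RHS](sum_c (fun=> 1)); apply: eq_bigr => u _; rewrite mulr1.
  rewrite /G; case: (_ == c) => //; rewrite /nu'; case: eqP => // /eqP mu_1.
  by rewrite -mulr_suml sum_eta divff // subr_eq0 eq_sym.
apply: (@FExs_intro _ _ _ _ _ _ _ _ G) => //.
- move=> s u; rewrite /G /nu'; case: ifP => _; first by rewrite ler0n.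
  by case: ifP => _; [rewrite ler0n | rewrite divr_ge0].
- by move=> u s s' ss'; rewrite /G (below_map c yN ss').
move=> X' HX' massX'; have XX' := kernel_below G1 massX'; split; last first.
  (* The implication fails with probability 0, because [G] is the point mass at [c] wherever [y]
     equals [c]. *)
  apply/fl => //; rewrite holds_mass // massX'.
  rewrite (eq_expect_holds (h' := fun=> 0) Xw).
    by rewrite /expect big1 // => e _; rewrite mulr0.
  move=> s /eqP sw; rewrite big1 // => u _.
  rewrite negb_imply (write_below _ _ (below_map _ yN)).
  have -> : map (write N u s) w = c.
    by rewrite -sw; apply/eq_in_map => v vw; rewrite /write (allP wN).
  have := map_write N u s; rewrite size_tuple -/z' => ->.
  by rewrite /G; case: (_ == c) => /=; rewrite ?mulr0 //; case: (_ == c); rewrite ?mulr0 ?mul0r.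
move=> a /=; rewrite (XX' _ (below_map _ zN)) -/(nu a).
rewrite (@eq_mass _ _ _ X' _ (fun s => (map s z' == val a) && true));
  last by move=> s; rewrite andbT.
rewrite (kernel_block (Q := xpredT) a massX') //.
(* The law of [z] is the mixture of the point mass at [c] and of [nu'] with weights [mu] and
   [1 - mu], matching the two cases of [G]. *)
have -> : nu a = mu * (val a == c)%:R + (1 - mu) * nu' a by rewrite nu'E addrCA subrr addr0.
have muC : 1 - mu = mass X (fun s => map s y != c).
  by apply/eqP; rewrite subr_eq addrC eq_sym; apply/eqP/mass_compl.
rewrite muC [mu]massE [X in _ + X * _]massE ![expect _ _ * _]mulrC -!expectZ -expectD.
by apply: eq_expect => s; rewrite /G; case: ifP => _; rewrite /= ?mulr1 ?mulr0 ?addr0 ?add0r.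
Qed.

Lemma sat_mass_eq N D X y z w (c : seq A) :
  is_team X -> size y = size w -> size z = size w ->
  all (fun v => v < N)%N (y ++ z ++ w) -> all (fun v => v \notin w) (y ++ z) ->
  {subset iota 0 N <= D} ->
  holds X (fun s => map s w == c) ->
  fo_sat D X (mass_eq t N y z w) <->
  mass X (fun s => map s y == c) = mass X (fun s => map s z == c).
Proof.
move=> HX yw zw yzN; rewrite all_cat => /andP[y_w z_w] DN Xw.
have zyN : all (fun v => v < N)%N (z ++ y ++ w).
  by move: yzN; rewrite !all_cat => /and3P[-> -> ->].
have le1 := sat_mass_le HX yw zw yzN y_w DN.
have le2 := sat_mass_le HX zw yw zyN z_w DN.
rewrite /mass_eq /=; split=> [H|yz]; last first.
  case=> /(sat_two_elements N D HX) ab; case.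
  by split; [apply/(le1 c ab Xw) | apply/(le2 c ab Xw)]; rewrite yz.
have [ab|nab] := EM (exists a b : A, a != b); last first.
  have A1 (a b : A) : a = b.
    by apply/eqP; apply/negPn/negP => ab; apply: nab; exists a, b.
  have cw : size c = size w by have [s /eqP <-] := holds_nonempty HX Xw; rewrite size_map.
  have all_c s x : size x = size w -> map s x == c.
    move=> xw; apply/eqP; apply: (@eq_from_nth _ (pt S)) => [|i _]; last exact: A1.
    by rewrite size_map xw cw.
  by apply: eq_mass => s; rewrite !all_c.
have [/(le1 c ab Xw) yz /(le2 c ab Xw) zy] :
    fo_sat D X (mass_le t N y z w) /\ fo_sat D X (mass_le t N z y w).
  apply: contrapT => nle; apply: H; split=> //.
  exact/(sat_two_elements N D HX).
by apply/le_anti; rewrite yz zy.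
Qed.

End Semantics.

(** * The translation *)

Section Translation.
Variable t : voc.
Implicit Types (rho : nat * nat -> nat) (sigma : nat -> nat) (N : nat).

(* rho maps a function symbol to the first variable of its block, sigma an
   element variable to its team variable; variables from N on are fresh. *)
Definition block rho (g : nat * nat) : seq nat := iota (rho g) g.1.

Definition bind (T : eqType) (r : T -> nat) (x : T) (N : nat) : T -> nat :=
  fun y => if y == x then N else r y.

(** By [good_atom] the arguments on the left determine those on the right, so only they are
    translated. Summed arguments come last, so the marginal is the initial segment of length [m1] of
    the block. *)
Definition tr_atom rho sigma N (i j : nterm) : fo t :=
  match i, j with
  | NF m1 f1 w, NMul (NF m2 f2 _) (NF m3 f3 _) =>
      mass_eq t N (block rho (m1, f1))
        (block rho (m2, f2) ++ block rho (m3, f3)) (map sigma w)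
  | NF m1 f1 u, NSum _ (NF m2 f2 _) =>
      mass_eq t N (block rho (m1, f1)) (iota (rho (m2, f2)) m1) (map sigma u)
  | _, _ => ftrue t
  end.

(** On constant variables a literal has one truth value throughout the support, so its Boolean
    negation agrees with the dual literal. Disjunction goes through De Morgan, since [FOr] would
    split the team. *)
Fixpoint tr_qf rho sigma N (th : soform t) : fo t :=
  match th with
  | SEq i j => tr_atom rho sigma N i j
  | SNEq i j => FNeg (tr_atom rho sigma N i j)
  | SRel r xs => FRel (map_tuple sigma xs)
  | SNRel r xs => FNeg (FRel (map_tuple sigma xs))
  | SEqv x y => FEq (sigma x) (sigma y)
  | SNEqv x y => FNeg (FEq (sigma x) (sigma y))
  | SAnd a b => FAnd (tr_qf rho sigma N a) (tr_qf rho sigma N b)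
  | SOr a b => FNeg (FAnd (FNeg (tr_qf rho sigma N a)) (FNeg (tr_qf rho sigma N b)))
  | _ => ftrue t
  end.

Fixpoint tr_all rho sigma N (xs : seq nat) (th : soform t) : fo t :=
  match xs with
  | [::] => tr_qf rho sigma N th
  | x :: xs' => FNeg (FExs (iota N 1) (FAnd (is_const t N)
                  (FNeg (tr_all rho (bind sigma x N) N.+1 xs' th))))
  end.

(** Independence from each earlier block separately is enough, as a product atom multiplies just two
    blocks. *)
Definition indep rho N m (fs : seq (nat * nat)) : fo t :=
  foldr (fun h phi => FAnd (FCInd [::] (iota N m) (block rho h)) phi) (ftrue t) fs.

Fixpoint tr_fun rho N fs qs xs th : fo t :=
  match qs with
  | [::] => tr_all rho (fun=> 0%N) N xs th
  | (q, (m, f)) :: qs' =>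
      let body := tr_fun (bind rho (m, f) N) (N + m) ((m, f) :: fs) qs' xs th in
      let ex phi := FExs (iota N m) (FAnd (indep rho N m fs) phi) in
      if q then ex body else FNeg (ex (FNeg body))
  end.

End Translation.

(** * Function environments represented by independent blocks, elements by constants *)

Lemma fupd_same (R : numFieldType) (t : voc) (S : struc t) (fe : fenv R S) m f g :
  fupd fe f g f = g :> (m.-tuple S -> R).
Proof.
rewrite /fupd; case: eqP => // e; rewrite eqxx.
(* Equality on [nat] is decidable, so the proof [e] of [m = m] is reflexivity and the cast
   disappears. *)
by rewrite (eq_axiomK e).
Qed.

Lemma fupd_other (R : numFieldType) (t : voc) (S : struc t) (fe : fenv R S) m f
  (g : m.-tuple S -> R) m' f' :
  (m', f') != (m, f) -> fupd fe f g f' = fe m' f'.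
Proof.
move=> /eqP ne; rewrite /fupd; case: eqP => // e; case: eqP => // ff.
by case: ne; rewrite e ff.
Qed.

Section Correctness.
Variables (R : numFieldType) (t : voc) (S : struc t).
Local Notation A := (dom S).
Local Notation asg := (nat -> A).
Local Notation team := (seq (asg * R)).
Implicit Types (X Y Z : team) (P Q : asg -> bool) (D : seq nat).
Implicit Types (rho : nat * nat -> nat) (sigma : nat -> nat) (N : nat) (s : asg).
Implicit Types (fe : fenv R S) (fs : seq (nat * nat)).

(** The invariant linking a team to a function environment. Independence is asked only of distinct
    symbols, which is why a product atom must not repeat a symbol. *)
Definition represents N X fs rho fe : Prop :=
  [/\ forall g, g \in fs -> (rho g + g.1 <= N)%N,
      forall g, g \in fs -> forall a : g.1.-tuple A,
        mass X (fun s => map s (block rho g) == val a) = fe g.1 g.2 a &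
      forall g h, g \in fs -> h \in fs -> g != h -> forall a b,
        size a = g.1 -> size b = h.1 ->
        mass X (fun s => (map s (block rho g) == a) && (map s (block rho h) == b)) =
        mass X (fun s => map s (block rho g) == a) * mass X (fun s => map s (block rho h) == b)].

(** The lower bound [M] keeps element variables apart from the blocks, which lie below [M];
    [mass_eq] is only analysed for such disjoint tuples. *)
Definition constants M N X (xs : seq nat) sigma s : Prop :=
  forall x, x \in xs ->
    (M <= sigma x < N)%N /\ holds X (fun s' => s' (sigma x) == s x).

Lemma block_below rho g N (c : seq A) : (rho g + g.1 <= N)%N ->
  below N (fun s => map s (block rho g) == c).
Proof.
move=> gN; apply: below_map; apply/allP => v; rewrite mem_iota => /andP[_ vg].
exact: leq_trans gN.
Qed.

Lemma belowI N P Q : below N P -> below N Q -> below N (fun s => P s && Q s).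
Proof. by move=> PN QN s s' ss'; rewrite (PN s s') // (QN s s'). Qed.

Lemma represents_conservative M N X X' fs rho fe : (M <= N)%N ->
  conservative N X X' -> represents M X fs rho fe -> represents M X' fs rho fe.
Proof.
move=> MN XX' [bnd marg ind].
have bl g c : g \in fs -> below N (fun s => map s (block rho g) == c).
  by move=> /bnd gM; apply: belowW MN (block_below _ gM).
split=> // [g gfs a|g h gfs hfs gh a b ag bh].
  by rewrite XX' ?marg //; apply: bl.
rewrite (XX' _ (belowI (bl _ a gfs) (bl _ b hfs))) (XX' _ (bl _ a gfs)).
by rewrite (XX' _ (bl _ b hfs)) ind.
Qed.

Lemma sat_independent D X N m r n : is_team X -> (r + n <= N)%N ->
  fo_sat D X (FCInd [::] (iota N m) (iota r n)) <->
  (forall a b, size a = m -> size b = n ->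
     mass X (fun s => (map s (iota N m) == a) && (map s (iota r n) == b)) =
     mass X (fun s => map s (iota N m) == a) * mass X (fun s => map s (iota r n) == b)).
Proof.
move=> HX rnN.
have agree_cat s s' : agree (iota N m ++ iota r n) s s' =
    (map s' (iota N m) == map s (iota N m)) && (map s' (iota r n) == map s (iota r n)).
  by rewrite /agree !map_cat eqseq_cat // !size_map.
have agree0 s : mass X (agree [::] s) = 1 by rewrite mass_true.
split=> [sat a b am bn|ind s] /=; last first.
  rewrite agree0 mulr1 [RHS](eq_mass X (agree_cat s)) ind //.
  - by rewrite size_map size_iota.
  - by rewrite size_map size_iota.
(* One assignment realises both values: the old block ends at or before [N], so writing [a] from [N]
   on does not disturb [b]. *)
pose s := write N a (write r b (fun=> pt S)).
have sa : map s (iota N m) = a by rewrite -am map_write.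
have sb : map s (iota r n) = b.
  have <- : map (write r b (fun=> pt S)) (iota r n) = b by rewrite -bn map_write.
  apply/eq_in_map => v; rewrite mem_iota => /andP[_ vn].
  by rewrite /s {1}/write (leq_trans vn).
have := sat s; rewrite /= agree0 mulr1 [X in _ = X](eq_mass X (agree_cat s)) sa sb => <-.
by congr (_ * _); apply: eq_mass => s'; rewrite /agree ?sa ?sb.
Qed.

Lemma sat_indep D X rho N m fs :
  fo_sat D X (indep t rho N m fs) <->
  forall h, h \in fs -> fo_sat D X (FCInd [::] (iota N m) (block rho h)).
Proof.
elim: fs => [|h fs IH]; first by split=> // _ a; apply: eq_mass.
split=> [[sat_h /IH sat_fs] h'|sat].
  by rewrite inE => /orP[/eqP->|/sat_fs].
split; first by apply: sat; rewrite mem_head.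
by apply/IH => h' h'fs; apply: sat; rewrite inE h'fs orbT.
Qed.

(** A symbol of [fs] may be quantified again: [bind] and [fupd] then shadow its old block and its
    old value together. *)
Lemma represents_bind D N X X' fs rho fe m f (g : m.-tuple A -> R) :
  is_team X' -> conservative N X X' -> represents N X fs rho fe ->
  (forall a : m.-tuple A, mass X' (fun s => map s (iota N m) == val a) = g a) ->
  fo_sat D X' (indep t rho N m fs) ->
  represents (N + m) X' ((m, f) :: fs) (bind rho (m, f) N) (fupd fe f g).
Proof.
move=> HX' XX' rep marg_g /sat_indep ind_g.
have [bnd marg ind] := represents_conservative (leqnn N) XX' rep.
have ind' h : h \in fs -> forall a b, size a = m -> size b = h.1 ->
    mass X' (fun s => (map s (iota N m) == a) && (map s (block rho h) == b)) =
    mass X' (fun s => map s (iota N m) == a) * mass X' (fun s => map s (block rho h) == b).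
  by move=> hfs; apply/sat_independent => //; [apply: bnd | apply: ind_g].
have blk h : block (bind rho (m, f) N) h = if h == (m, f) then iota N m else block rho h.
  by rewrite /block /bind; case: eqP => [->|].
split.
- move=> h; rewrite inE /bind; case: eqP => [-> _|_ /= /bnd hN] //.
  exact: leq_trans (leq_addr _ _).
- move=> h; rewrite inE blk; case: (eqVneq h (m, f)) => [-> _ a|hmf /= hfs a] /=.
    by rewrite fupd_same marg_g.
  rewrite marg // fupd_other //.
- move=> h h'; rewrite !inE !blk.
  case: (eqVneq h (m, f)) => [-> _|hmf /= hfs]; case: (eqVneq h' (m, f)) => [->|h'mf] //=.
  + by move=> h'fs _ a b; apply: ind'.
  + move=> _ _ a b ah bm; rewrite mulrC -ind' //.
    by apply: eq_mass => s; rewrite andbC.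
  + by move=> h'fs hh' a b; apply: ind.
Qed.

(** Self-independence says that the probability of each value equals its own square, hence is 0 or
    1. The probabilities sum to 1, so some value has probability 1. *)
Lemma sat_const D X x : is_team X ->
  fo_sat D X (is_const t x) <-> exists a, holds X (fun s => s x == a).
Proof.
move=> HX.
have agreex y s s' : y \in [:: [:: x]; [:: x; x]] -> agree y s s' = (s' x == s x).
  by rewrite !inE => /orP[]/eqP->; rewrite /agree /= !eqseq_cons ?andbT ?andbb.
have agree0 s : mass X (agree [::] s) = 1 by rewrite mass_true.
split=> [sat|[a Xa] s] /=; last first.
  have mX y : y \in [:: [:: x]; [:: x; x]] -> mass X (agree y s) = (a == s x)%:R.
    move=> yx; rewrite (@eq_mass_holds _ _ _ _ _ _ (fun=> a == s x) Xa).
      by case: (_ == _); [rewrite mass_true | rewrite /mass big_pred0_eq].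
    by move=> s' /eqP <-; apply: agreex.
  rewrite agree0 mulr1 !mX ?inE ?eqxx ?orbT //.
  by case: (_ == _); rewrite ?mulr1 ?mulr0.
have idem a : mass X (fun s => s x == a) * mass X (fun s => s x == a) = mass X (fun s => s x == a).
  have mE y : y \in [:: [:: x]; [:: x; x]] ->
      mass X (agree y (fun=> a)) = mass X (fun s => s x == a).
    by move=> yx; apply: eq_mass => s'; rewrite agreex.
  have := sat (fun=> a); rewrite /= agree0 mulr1.
  by rewrite !mE ?inE ?eqxx ?orbT.
apply: contrapT => no; suff: \sum_a mass X (fun s => s x == a) = 1.
  rewrite big1 => [/esym/eqP|a _]; first by rewrite oner_eq0.
  apply: contrapT => /eqP m0; apply: no; exists a; rewrite holds_mass1 //.
  by rewrite -(inj_eq (mulfI m0)) idem mulr1.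
under eq_bigr do rewrite massE.
rewrite expect_sum -[RHS](expect1 HX); apply: eq_expect => s.
by rewrite (bigD1 (s x)) //= eqxx big1 ?addr0 // => a; rewrite eq_sym => /negbTE ->.
Qed.

End Correctness.

(** * Numerical atoms and quantifier-free formulas over constant variables *)

Section NumericalAtoms.
Variables (R : numFieldType) (t : voc) (S : struc t).
Local Notation A := (dom S).
Local Notation asg := (nat -> A).
Local Notation team := (seq (asg * R)).
Implicit Types (X Y Z : team) (P Q : asg -> bool) (D : seq nat).
Implicit Types (rho : nat * nat -> nat) (sigma : nat -> nat) (N : nat) (s : asg).
Implicit Types (fe : fenv R S) (fs : seq (nat * nat)).

Lemma holds_constants M N X xs sigma s (w : seq nat) :
  constants M N X xs sigma s -> all (fun y => y \in xs) w ->
  holds X (fun s' => map s' (map sigma w) == map s w).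
Proof.
move=> con; elim: w => [|x w IH] /=; first by move=> _; apply: holdsT.
case/andP=> /con[_ Xx] /IH Xw.
by apply: holdsW (_ : holds X (fun s' => (s' (sigma x) == s x) &&
                          (map s' (map sigma w) == map s w))) => [s'|];
  [rewrite eqseq_cons | rewrite holdsI Xx].
Qed.

(** The total weight is 1, so the support is nonempty and a predicate that is constantly false on it
    cannot hold vacuously. This makes Boolean negation of literals correct. *)
Lemma holds_cst X T P b : is_team X -> holds X T -> (forall s, T s -> P s = b) ->
  holds X P = b.
Proof.
move=> HX XT TP; rewrite holds_mass1 // (@eq_mass_holds _ _ _ _ _ _ (fun=> b) XT) //.
by case: b {TP}; [rewrite mass_true // eqxx | rewrite /mass big_pred0_eq eq_sym oner_eq0].
Qed.

Lemma updl_notin s (v : seq nat) (b : seq A) (u : seq nat) :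
  all (fun y => y \notin v) u -> map (updl s v b) u = map s u.
Proof. by move=> uv; apply/eq_in_map => y /(allP uv) /negbTE yv; rewrite /updl yv. Qed.

Lemma updl_in s (v : seq nat) (b : seq A) :
  uniq v -> size b = size v -> map (updl s v b) v = b.
Proof.
move=> uv bv; apply: (@eq_from_nth _ (pt S)) => [|i]; rewrite size_map // => iv.
rewrite (nth_map 0%N) // /updl mem_nth // index_uniq //.
by apply: set_nth_default; rewrite bv.
Qed.

Lemma constants_notin M N X xs sigma s w rho g m :
  constants M N X xs sigma s -> all (fun y => y \in xs) w ->
  (rho g + m <= M)%N -> all (fun v => v \notin map sigma w) (iota (rho g) m).
Proof.
move=> con wxs gM; apply/allP => v; rewrite mem_iota => /andP[_ vg].
apply/mapP => -[x /(allP wxs)/con[/andP[Mx _] _] vx].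
by have := leq_trans vg gM; rewrite vx ltnNge Mx.
Qed.

Lemma constants_lt M N X xs sigma s w :
  constants M N X xs sigma s -> all (fun y => y \in xs) w ->
  all (fun v => v < N)%N (map sigma w).
Proof.
move=> con wxs; rewrite all_map; apply/allP => x /(allP wxs)/con[/andP[_ xN] _].
exact: xN.
Qed.

Lemma iota_lt a n M N : (a + n <= M)%N -> (M <= N)%N -> all (fun v => v < N)%N (iota a n).
Proof.
move=> aM MN; apply/allP => v; rewrite mem_iota => /andP[_ va].
exact: leq_trans va (leq_trans aM MN).
Qed.

Section QuantifierFree.
Variables (M N : nat) (D : seq nat) (X : team) (xs : seq nat) (fs0 fs : seq (nat * nat)).
Variables (rho : nat * nat -> nat) (sigma : nat -> nat) (s : asg) (fe : fenv R S).
Hypotheses (HX : is_team X) (MN : (M <= N)%N) (DN : {subset iota 0 N <= D}).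
Hypotheses (rep : represents M X fs rho fe) (con : constants M N X xs sigma s).
Hypothesis (fs0fs : {subset fs0 <= fs}).

Lemma sat_tr_atom i j : good_atom fs0 xs i j ->
  fo_sat D X (tr_atom t rho sigma N i j) <-> neval s fe i = neval s fe j.
Proof.
have [bnd marg ind] := rep.
have margE s0 m f (w : m.-tuple nat) : (m, f) \in fs ->
    mass X (fun s' => map s' (block rho (m, f)) == map s0 w) = fe f (map_tuple s0 w).
  by move=> /marg <-.
case: i => [m1 f1 w|//|//]; case: j => [//|[m2 f2 u|//|//] [m3 f3 v|//|//]|v [m2 f2 w'|//|//]].
  case/and4P=> /eqP wuv unq /allP mem wxs.
  have g1 : (m1, f1) \in fs by apply/fs0fs/mem; rewrite !inE eqxx.
  have g2 : (m2, f2) \in fs by apply/fs0fs/mem; rewrite !inE eqxx orbT.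
  have g3 : (m3, f3) \in fs by apply/fs0fs/mem; rewrite !inE eqxx !orbT.
  have m123 : m1 = (m2 + m3)%N.
    by have := congr1 size wuv; rewrite size_cat !size_tuple.
  rewrite [tr_atom _ _ _ _ _ _]/tr_atom (sat_mass_eq (c := map s w)) //=.
  (* Independence of the two blocks, available because the symbols are distinct, turns the product
     of values into one joint mass. *)
  - rewrite /= -!margE // -ind ?size_map ?size_tuple //; last first.
      by move: unq; rewrite /= !inE negb_or => /and3P[].
    rewrite [X in _ = X <-> _](@eq_mass _ _ _ X _ (fun s' =>
      (map s' (block rho (m2, f2)) == map s u) && (map s' (block rho (m3, f3)) == map s v))) //.
    by move=> s'; rewrite wuv !map_cat eqseq_cat // !size_map size_iota size_tuple.
  - by rewrite size_map size_tuple size_iota.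
  - by rewrite size_map size_cat !size_iota size_tuple m123.
  - by rewrite !all_cat !(iota_lt _ MN) ?bnd // (constants_lt con wxs).
  - by rewrite !all_cat !(constants_notin con wxs) // bnd.
  - exact: holds_constants con wxs.
case/and5P=> /eqP wuv uv vu _ /andP[/allP mem uxs].
have g1 : (m1, f1) \in fs by apply/fs0fs/mem; rewrite !inE eqxx.
have g2 : (m2, f2) \in fs by apply/fs0fs/mem; rewrite !inE eqxx orbT.
have m2E : m2 = (m1 + size v)%N.
  by have := congr1 size wuv; rewrite size_cat !size_tuple.
have b2 : (rho (m2, f2) + m1 <= M)%N.
  by apply: leq_trans (bnd _ g2); rewrite /= m2E leq_add2l leq_addr.
rewrite [tr_atom _ _ _ _ _ _]/tr_atom (sat_mass_eq (c := map s w)) //=.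
(* The mass of the initial segment is split over the values of the remaining [size v] variables;
   each piece is the mass of the whole block at the arguments of one summand of SUM. *)
- rewrite /= -margE // -[X in _ = X <-> _](sum_mass X _ (n := size v)
    (y := iota (rho (m2, f2) + m1) (size v))) ?size_iota //.
  under [in X in _ <-> _ = X]eq_bigr => b _.
    rewrite -margE // [X in mass _ X](_ : _ = fun s' =>
      (map s' (iota (rho (m2, f2) + m1) (size v)) == val b) &&
      (map s' (iota (rho (m2, f2)) m1) == map s w)); last first.
      apply: funext => s'; rewrite wuv map_cat updl_notin // updl_in ?size_tuple //.
      by rewrite /block /= m2E iotaD map_cat eqseq_cat ?size_map ?size_iota ?size_tuple // andbC.
    over.
  by [].
- by rewrite size_map size_tuple size_iota.
- by rewrite size_map size_iota size_tuple.
- by rewrite !all_cat !(iota_lt _ MN) ?bnd // (constants_lt con uxs).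
- by rewrite !all_cat !(constants_notin con uxs) // bnd.
- exact: holds_constants con uxs.
Qed.

Lemma sat_tr_qf th : good_qf fs0 xs th ->
  fo_sat D X (tr_qf rho sigma N th) <-> so_sat s fe th.
Proof.
have eqS x y : (x \in xs) && (y \in xs) ->
    fo_sat D X (FEq (t := t) (sigma x) (sigma y)) <-> s x = s y.
  case/andP=> xxs yxs; have Xxy := @holds_constants _ _ _ _ _ _ [:: x; y] con.
  rewrite /= -/(holds X (fun s' => s' (sigma x) == s' (sigma y))).
  rewrite (holds_cst (b := s x == s y) HX (Xxy _)) /= ?xxs ?yxs //.
    by split=> /eqP.
  by move=> s' /eqP[-> ->].
have relS r (ys : (ar r).-tuple nat) : all (fun y => y \in xs) ys ->
    fo_sat D X (FRel (map_tuple sigma ys)) <-> interp (map_tuple s ys).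
  move=> ysxs; have Xys := holds_constants con ysxs.
  rewrite /= -/(holds X (fun s' => interp (map_tuple s' (map_tuple sigma ys)))).
  rewrite (holds_cst (b := interp (map_tuple s ys)) HX Xys) // => s' /eqP s'E.
  by congr interp; apply: val_inj.
elim: th => //=.
- exact: sat_tr_atom.
- by move=> i j /sat_tr_atom ij; split=> H /ij.
- by move=> r ys /relS H; split=> [nH|/negP nH /H //]; apply/negP => /H.
- by move=> x y /eqS H; split=> nH /H.
- move=> a IHa b IHb /andP[/IHa Ha /IHb Hb].
  by split=> -[/Ha ? /Hb ?].
- move=> a IHa b IHb /andP[/IHa Ha /IHb Hb]; split=> [H|[/Ha|/Hb] ? []//].
  by apply: contrapT => nab; apply: H; split=> [/Ha|/Hb] ?; apply: nab; [left|right].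
Qed.

End QuantifierFree.

End NumericalAtoms.

(** * Quantifiers over elements and over distributions *)

Lemma sub_catrev N m D :
  {subset iota 0 N <= D} -> {subset iota 0 (N + m) <= catrev (iota N m) D}.
Proof.
move=> DN v; rewrite catrevE mem_cat mem_rev iotaD mem_cat add0n orbC.
by case/orP=> [->//|/DN ->]; rewrite orbT.
Qed.

Section Quantifiers.
Variables (R : numFieldType) (t : voc) (S : struc t).
Local Notation A := (dom S).
Local Notation asg := (nat -> A).
Local Notation team := (seq (asg * R)).
Implicit Types (X Y Z : team) (P Q : asg -> bool) (D : seq nat).
Implicit Types (rho : nat * nat -> nat) (sigma : nat -> nat) (N : nat) (s : asg).
Implicit Types (fe : fenv R S) (fs : seq (nat * nat)).

Lemma constants_bind M N X X' xs sigma s x a : (M <= N)%N ->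
  is_team X -> is_team X' -> conservative N X X' -> constants M N X xs sigma s ->
  holds X' (fun s' => s' N == a) ->
  constants M N.+1 X' (x :: xs) (bind sigma x N) (updA s x a).
Proof.
move=> MN HX HX' XX' con Xa y; rewrite inE /bind /updA.
case: (eqVneq y x) => [_ _|_ /= /con[/andP[My yN] Xy]]; first by rewrite MN ltnSn.
rewrite My ltnW //; split=> //; rewrite (holds_conservative HX HX' XX') //.
by move=> s1 s2 ->.
Qed.

Lemma all_leq_iota N m : all (leq N) (iota N m).
Proof. by apply/allP => v; rewrite mem_iota => /andP[]. Qed.

Lemma indic_dist m (a : m.-tuple A) :
  \sum_(u : m.-tuple A) (val u == val a)%:R = 1 :> R.
Proof.
rewrite -[RHS](sum_indic_tuple a (fun=> 1)).
by apply: eq_bigr => u _; rewrite mulr1.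
Qed.

(** [sc] collects the variables bound so far. [M] stays fixed while [N] grows, since element
    quantifiers add no blocks. *)
Lemma sat_tr_all th xs fs0 fs rho fe M xs' N D X sc sigma s :
  {subset fs0 <= fs} -> good_qf fs0 xs th -> {subset xs <= sc ++ xs'} ->
  is_team X -> (M <= N)%N -> {subset iota 0 N <= D} ->
  represents M X fs rho fe -> constants M N X sc sigma s ->
  fo_sat D X (tr_all rho sigma N xs' th) <-> so_sat s fe (foldr (@SAll t) th xs').
Proof.
move=> fs0fs good; elim: xs' N D X sc sigma s => [|x xs' IH] N D X sc sigma s xsc HX MN DN rep con.
  apply: (sat_tr_qf HX MN DN rep (xs := xs) _ fs0fs) => // x /xsc.
  by rewrite cats0 => /con.
have xsc' : {subset xs <= (x :: sc) ++ xs'}.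
  by move=> y /xsc; rewrite !mem_cat !inE orbA [(y == x) || _]orbC.
have DN' : {subset iota 0 N.+1 <= catrev (iota N 1) D}.
  by rewrite -addn1; apply: sub_catrev.
have IH' X' a : is_team X' -> conservative N X X' -> holds X' (fun s' => s' N == a) ->
    fo_sat (catrev (iota N 1) D) X' (tr_all rho (bind sigma x N) N.+1 xs' th) <->
    so_sat (updA s x a) fe (foldr (@SAll t) th xs').
  move=> HX' XX' Xa; apply: (IH _ _ _ (x :: sc)) => //; first exact: leqW.
    exact: represents_conservative MN XX' rep.
  exact: constants_bind HX HX' XX' con Xa.
change (~ fo_sat D X (FExs (iota N 1) (FAnd (is_const t N)
    (FNeg (tr_all rho (bind sigma x N) N.+1 xs' th)))) <->
  forall a, so_sat (updA s x a) fe (foldr (@SAll t) th xs')).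
split=> [nsat a|sat].
  apply: contrapT => na; apply: nsat.
  have G1 (_ : asg) : \sum_(u : 1.-tuple A) (val u == [:: a])%:R = 1 :> R.
    exact: (indic_dist [tuple a]).
  (* The fresh variable receives the point mass at the counterexample [a]. *)
  apply: (@FExs_intro _ _ _ _ _ _ _ _ (fun _ u => (u == [:: a])%:R)) => //.
  move=> X' HX' massX'.
  have Xa : holds X' (fun s' => s' N == a).
    rewrite holds_mass1 // massX'; apply/eqP; rewrite -[RHS](expect1 HX).
    apply: eq_expect => s'.
    rewrite (sum_indic_tuple [tuple a] (fun u => (write N u s' N == a)%:R)).
    by rewrite /write ltnn subnn /= eqxx.
  split; first by apply/sat_const => //; exists a.
  move=> /IH' -/(_ a HX' _ Xa) H; apply: na; apply: H.
  exact: (@kernel_below _ _ _ N 1 (fun _ u => (u == [:: a])%:R) X X' G1 massX').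
move/(FExs_elim (all_leq_iota N 1) HX) => [X' [HX' XX' [isc nbody]]].
have [a Xa] := iffLR (sat_const (catrev (iota N 1) D) N HX') isc.
by apply: nbody; apply/(IH' _ a) => //; apply: sat.
Qed.

(** The quantified distribution is read off as the marginal law of the new block. *)
Lemma sat_ex_fun D N X fs rho fe m f body :
  is_team X -> represents N X fs rho fe ->
  fo_sat D X (FExs (iota N m) (FAnd (indep t rho N m fs) body)) ->
  exists (g : m.-tuple A -> R) X', [/\ is_dist g, is_team X',
    represents (N + m) X' ((m, f) :: fs) (bind rho (m, f) N) (fupd fe f g) &
    fo_sat (catrev (iota N m) D) X' body].
Proof.
move=> HX rep /(FExs_elim (all_leq_iota N m) HX) [X' [HX' XX' [ind sat]]].
pose g (a : m.-tuple A) := mass X' (fun s => map s (iota N m) == val a).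
exists g, X'; split=> //; last exact: (represents_bind (g := g) f HX' XX' rep (fun=> erefl) ind).
split=> [a|]; first exact: mass_ge0.
rewrite -(mass_true HX' (P := xpredT)) // -(sum_mass X' xpredT (size_iota N m)).
by apply: eq_bigr => a _; apply: eq_mass => s; rewrite andbT.
Qed.

(** The block is drawn from [g] by a kernel that ignores the assignment, which makes it independent
    of everything below [N]. *)
Lemma ex_fun_sat D N X fs rho fe m f body (g : m.-tuple A -> R) :
  is_team X -> represents N X fs rho fe -> is_dist g ->
  (forall X', is_team X' ->
     represents (N + m) X' ((m, f) :: fs) (bind rho (m, f) N) (fupd fe f g) ->
     fo_sat (catrev (iota N m) D) X' body) ->
  fo_sat D X (FExs (iota N m) (FAnd (indep t rho N m fs) body)).
Proof.
move=> HX rep [g0 g1] H.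
(* Kernels are functions of lists; on lists of a length other than [m] this one is 0. *)
pose G (_ : asg) (u : seq A) := if insub u is Some a then g a else 0.
have GE s (a : m.-tuple A) : G s a = g a by rewrite /G valK.
have G1 s : \sum_(u : m.-tuple A) G s u = 1.
  by rewrite -[RHS]g1; apply: eq_bigr => a _.
apply: (@FExs_intro _ _ _ _ _ _ _ _ G) => //.
  by move=> s u; rewrite /G; case: insubP.
move=> X' HX' massX'; have XX' := kernel_below G1 massX'.
have joint (a : m.-tuple A) Q : below N Q ->
    mass X' (fun s => (map s (iota N m) == val a) && Q s) = g a * mass X' Q.
  move=> QN; rewrite (kernel_block a massX' QN) (XX' _ QN) massE -expectZ.
  by apply: eq_expect => s; rewrite GE.
have marg (a : m.-tuple A) : mass X' (fun s => map s (iota N m) == val a) = g a.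
  rewrite (@eq_mass _ _ _ X' _ (fun s => (map s (iota N m) == val a) && true)).
    by rewrite joint // (mass_true HX') // mulr1.
  by move=> s; rewrite andbT.
have ind : fo_sat (catrev (iota N m) D) X' (indep t rho N m fs).
  apply/sat_indep => h hfs; have hN : (rho h + h.1 <= N)%N by case: rep => + _ _; apply.
  apply/sat_independent => // a b /eqP am _; rewrite -[a]/(val (Tuple am)) marg.
  by apply: joint; apply: block_below hN.
by split=> //; apply: H => //; apply: (represents_bind f HX' XX' rep marg ind).
Qed.

(** The equivalence is proved for every team representing the environment, so the induction
    hypothesis applies to whichever extension the quantifier step produces. *)
Lemma sat_tr_fun th xs qs N D X fs0 fs rho fe :
  {subset fs0 <= fs ++ [seq q.2 | q <- qs]} -> good_qf fs0 xs th ->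
  is_team X -> {subset iota 0 N <= D} -> represents N X fs rho fe ->
  fo_sat D X (tr_fun rho N fs qs xs th) <->
  so_sat (fun=> pt S) fe (fprefix qs (foldr (@SAll t) th xs)).
Proof.
move=> + good; elim: qs N D X fs rho fe => [|[q [m f]] qs IH] N D X fs rho fe fs0fs HX DN rep.
  rewrite cats0 in fs0fs.
  exact: (sat_tr_all (sc := [::]) fs0fs good _ HX (leqnn N) DN rep).
have fs0fs' : {subset fs0 <= ((m, f) :: fs) ++ [seq q.2 | q <- qs]}.
  by move=> h /fs0fs; rewrite !mem_cat !inE orbA [(h == _) || _]orbC.
have IH' X' fe' : is_team X' ->
    represents (N + m) X' ((m, f) :: fs) (bind rho (m, f) N) fe' ->
    fo_sat (catrev (iota N m) D) X' (tr_fun (bind rho (m, f) N) (N + m) ((m, f) :: fs) qs xs th) <->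
    so_sat (fun=> pt S) fe' (fprefix qs (foldr (@SAll t) th xs)).
  by move=> HX' rep'; apply: IH => //; apply: sub_catrev.
rewrite /fprefix [foldr _ _ (_ :: _)]/= [tr_fun _ _ _ (_ :: _) _ _]/= -/(fprefix _ _).
case: q {fs0fs}; split.
- move=> /(sat_ex_fun f HX rep)[g [X' [Hg HX' rep' /(IH' _ _ HX' rep')]]].
  by exists g.
- move=> [g [Hg sat]]; apply: (ex_fun_sat (f := f) HX rep Hg) => X' HX' rep'.
  exact/(IH' _ _ HX' rep').
(* For a universal quantifier the two existential lemmas are applied to the negated body, with
   classical contraposition. *)
- move=> nsat g Hg; apply: contrapT => ng; apply: nsat.
  apply: (ex_fun_sat (f := f) HX rep Hg) => X' HX' rep' /(IH' _ _ HX' rep').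
  exact: ng.
- move=> sat /(sat_ex_fun f HX rep)[g [X' [Hg HX' rep' nbody]]].
  by apply: nbody; apply/(IH' _ _ HX' rep'); apply: sat.
Qed.

(** The variables of the given team form the block of [p]; with a single symbol the independence
    clause is vacuous. *)
Lemma team_of_represents k pn (pA : k.-tuple A -> R) rho : is_dist pA -> rho (k, pn) = 0%N ->
  is_team (team_of pA) /\
  represents k (team_of pA) [:: (k, pn)] rho (fupd (fun _ _ _ => 0) pn pA).
Proof.
move=> [p0 p1] rho0; split.
  split; last by rewrite big_map big_enum.
  by rewrite all_map; apply/allP => a _; apply: p0.
split=> [g|g|g h]; rewrite !inE => /eqP->; first by rewrite rho0.
  move=> a; rewrite /= fupd_same /mass big_map big_enum_cond /=.
  rewrite (big_pred1 a) // => b; rewrite /block rho0 /=.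
  rewrite -val_eqE /=; congr (_ == _).
  by rewrite -[RHS](mkseq_nth (pt S)) size_tuple.
by move=> /eqP->; rewrite eqxx.
Qed.

End Quantifiers.

(** * Free variables of the translation *)

Section FreeVariables.
Variable t : voc.
Implicit Types (rho : nat * nat -> nat) (sigma : nat -> nat) (N : nat) (phi : fo t).

Definition fv_lt N phi := all (fun v => v < N)%N (fo_fv phi).

Lemma fv_lt_FExs N m phi : fv_lt (N + m) phi -> fv_lt N (FExs (iota N m) phi).
Proof.
have fvE xs v : v \in fo_fv (FExs xs phi) -> (v \in fo_fv phi) && (v \notin xs).
  elim: xs => [|x xs IH] /=; first by move=> ->.
  by rewrite mem_filter inE negb_or => /andP[-> /IH].
move=> /allP H; apply/allP => v /fvE/andP[/H vNm]; rewrite mem_iota vNm andbT.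
by rewrite -ltnNge.
Qed.

Lemma fv_lt_mass_le N y z w : size y = size w -> size z = size w ->
  all (fun v => v < N)%N (y ++ z ++ w) -> fv_lt N (mass_le t N y z w).
Proof.
move=> yw zw; rewrite !all_cat => /and3P[yN zN wN]; apply: fv_lt_FExs.
have lt v : (v < N)%N -> (v < N + size z)%N by move=> vN; rewrite ltn_addr.
rewrite /fv_lt /= !all_cat (sub_all lt zN) /=.
have z'N : all (fun v => v < N + size z)%N (iota N (size z)).
  by apply/allP => v; rewrite mem_iota => /andP[].
rewrite z'N /= /fimpl.
have : {subset zip (iota N (size z)) w <= zip (iota N (size z)) w} by [].
elim: {1 3}(zip _ w) => //= q qs IH sub; rewrite all_cat IH ?andbT; last first.
  by move=> r rqs; apply: sub; rewrite inE rqs orbT.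
have [q1 q2] := mem_zip (sub q (mem_head _ _)).
have : {subset zip y w <= zip y w} by [].
elim: {1 3}(zip y w) => [_|p ps IHp subp] /=.
  by rewrite (allP z'N) // lt // (allP wN).
have [p1 p2] := mem_zip (subp p (mem_head _ _)).
rewrite !lt ?(allP yN _ p1) ?(allP wN _ p2) //=; apply: IHp => r rps.
by apply: subp; rewrite inE rps orbT.
Qed.

Lemma fv_lt_mass_eq N y z w : size y = size w -> size z = size w ->
  all (fun v => v < N)%N (y ++ z ++ w) -> fv_lt N (mass_eq t N y z w).
Proof.
move=> yw zw yzN; rewrite /fv_lt [fo_fv _]/= !all_cat.
rewrite -!/(fv_lt N _) !fv_lt_mass_le //; last first.
  by move: yzN; rewrite !all_cat => /and3P[-> -> ->].
rewrite !andbT -[X in is_true X]/(fv_lt N (two_elements t N)).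
by apply: fv_lt_FExs; rewrite /fv_lt /= addn2 !leqnn leqnSn.
Qed.

Lemma fv_lt_tr_qf fs xs rho sigma N th :
  (forall g, g \in fs -> rho g + g.1 <= N)%N -> (forall x, x \in xs -> sigma x < N)%N ->
  good_qf fs xs th -> fv_lt N (tr_qf rho sigma N th).
Proof.
move=> rhoN sigmaN.
have mapN w : all (fun y => y \in xs) w -> all (fun v => v < N)%N (map sigma w).
  by move=> wxs; rewrite all_map; apply: sub_all wxs => x /sigmaN.
have atomN i j : good_atom fs xs i j -> fv_lt N (tr_atom t rho sigma N i j).
  case: i => [m1 f1 w|//|//]; case: j => [//|[m2 f2 u|//|//] [m3 f3 v|//|//]|v [m2 f2 w'|//|//]].
    case/and4P=> /eqP wuv _ /allP mem wxs.
    have g1 : (m1, f1) \in fs by apply/mem; rewrite !inE eqxx.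
    have g2 : (m2, f2) \in fs by apply/mem; rewrite !inE eqxx orbT.
    have g3 : (m3, f3) \in fs by apply/mem; rewrite !inE eqxx !orbT.
    have m123 : m1 = (m2 + m3)%N.
      by have := congr1 size wuv; rewrite size_cat !size_tuple.
    apply: fv_lt_mass_eq; rewrite ?size_cat ?size_map ?size_iota ?size_tuple //.
    by rewrite !all_cat !(iota_lt _ (leqnn N)) ?rhoN //= mapN.
  case/and5P=> /eqP wuv uv vu _ /andP[/allP mem uxs].
  have g1 : (m1, f1) \in fs by apply/mem; rewrite !inE eqxx.
  have g2 : (m2, f2) \in fs by apply/mem; rewrite !inE eqxx orbT.
  have m2E : m2 = (m1 + size v)%N.
    by have := congr1 size wuv; rewrite size_cat !size_tuple.
  have b2 : (rho (m2, f2) + m1 <= N)%N.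
    by apply: leq_trans (rhoN _ g2); rewrite /= m2E leq_add2l leq_addr.
  apply: fv_lt_mass_eq; rewrite ?size_map ?size_iota ?size_tuple //.
  by rewrite !all_cat !(iota_lt _ (leqnn N)) ?rhoN //= mapN.
rewrite /fv_lt; elim: th => //= [r ys /mapN|r ys /mapN|x y|x y|a IHa b IHb|a IHa b IHb] //.
- by move=> /andP[/sigmaN -> /sigmaN ->].
- by move=> /andP[/sigmaN -> /sigmaN ->].
- by rewrite all_cat => /andP[/IHa -> /IHb ->].
- by rewrite all_cat => /andP[/IHa -> /IHb ->].
Qed.

Lemma fv_lt_tr_all fs xs rho xs' sc sigma N th :
  {subset xs <= sc ++ xs'} ->
  (forall g, g \in fs -> rho g + g.1 <= N)%N -> (forall x, x \in sc -> sigma x < N)%N ->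
  good_qf fs xs th -> fv_lt N (tr_all rho sigma N xs' th).
Proof.
elim: xs' sc sigma N => [|x xs' IH] sc sigma N xsc rhoN sigmaN good.
  rewrite cats0 in xsc.
  by apply: (fv_lt_tr_qf rhoN _ good) => x /xsc /sigmaN.
have body : fv_lt (N + 1) (tr_all rho (bind sigma x N) N.+1 xs' th).
  rewrite addn1; apply: (IH (x :: sc)) => //.
  - by move=> y /xsc; rewrite !mem_cat !inE orbA [(y == x) || _]orbC.
  - by move=> g /rhoN gN; apply: leqW.
  - move=> y; rewrite inE /bind; case: eqP => [_ _|_ /= /sigmaN yN]; first exact: ltnSn.
    exact: leqW.
change (fv_lt N (FExs (iota N 1) (FAnd (is_const t N)
  (FNeg (tr_all rho (bind sigma x N) N.+1 xs' th))))).
rewrite addn1 in body; apply: fv_lt_FExs; rewrite addn1 /fv_lt /= ltnSn /=. exact: body.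
Qed.

Lemma fv_lt_tr_fun fs0 xs qs rho N fs th :
  {subset fs0 <= fs ++ [seq q.2 | q <- qs]} ->
  (forall g, g \in fs -> rho g + g.1 <= N)%N ->
  good_qf fs0 xs th -> fv_lt N (tr_fun rho N fs qs xs th).
Proof.
elim: qs rho N fs => [|[q [m f]] qs IH] rho N fs fs0fs rhoN good.
  rewrite cats0 in fs0fs.
  by apply: (@fv_lt_tr_all fs0 xs _ _ [::]) => // g /fs0fs /rhoN.
have body : fv_lt (N + m) (tr_fun (bind rho (m, f) N) (N + m) ((m, f) :: fs) qs xs th).
  apply: IH => //.
    by move=> h /fs0fs; rewrite !mem_cat !inE orbA [(h == _) || _]orbC.
  move=> h; rewrite inE /bind; case: eqP => [-> _|_ /= /rhoN hN] //.
  exact: leq_trans (leq_addr _ _).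
have indN : fv_lt (N + m) (indep t rho N m fs).
  elim: (fs) {fs0fs IH body} rhoN => //= h hs IHhs rhoN.
  rewrite /fv_lt /= !all_cat -/(fv_lt _ _) IHhs ?andbT; last first.
    by move=> g ghs; apply: rhoN; rewrite inE ghs orbT.
  apply/andP; split; first by apply/allP => v; rewrite mem_iota => /andP[].
  by apply: (@iota_lt _ _ N); rewrite ?leq_addr // rhoN // mem_head.
have conj phi : fv_lt (N + m) phi -> fv_lt N (FExs (iota N m) (FAnd (indep t rho N m fs) phi)).
  by move=> phiN; apply: fv_lt_FExs; rewrite /fv_lt /= all_cat; apply/andP.
by rewrite /=; case: q {fs0fs}; apply: conj.
Qed.

End FreeVariables.

Theorem mainTheorem6 (t : voc) (k pn : nat) (phi : soform t) :
  so_shape k pn phi ->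
  exists Phi : fo t,
    {subset fo_fv Phi <= iota 0 k} /\
    forall (R : realType) (S : struc t) (pA : k.-tuple S -> R),
      is_dist pA ->
      (fo_sat (iota 0 k) (team_of pA) Phi <-> so_holds pn pA phi).
Proof.
case=> qs [xs [th [-> good]]].
(* At the start [p] is the only symbol, its block begins at variable 0, and [k] is the first fresh
   variable. *)
exists (tr_fun (fun=> 0%N) k [:: (k, pn)] qs xs th); split.
  move=> v /(allP (fv_lt_tr_fun (fs := [:: (k, pn)]) _ _ good)) -/(_ _ _) vk.
  rewrite mem_iota; apply: vk => //.
  by move=> g; rewrite inE => /eqP->.
move=> R S pA HpA.
have [HX rep] := team_of_represents HpA (erefl : (fun=> 0%N) (k, pn) = 0%N).
exact: sat_tr_fun good HX _ rep.
Qed.
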